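(* Let $P_{ac}(\mathbb{R})$ be the set of Borel probability measures on $\mathbb{R}$ that are absolutely continuous with respect to Lebesgue measure, and let $\phi\colon P_{ac}(\mathbb{R})\to P_{ac}(\mathbb{R})$ be a surjective map with $d_{Ku}(\phi(\mu),\phi(\nu))=d_{Ku}(\mu,\nu)$ for all $\mu,\nu\in P_{ac}(\mathbb{R})$. Then there exist a bijection $g\colon\mathbb{R}\to\mathbb{R}$ such that $g$ and $g^{-1}$ are absolutely continuous on every compact interval, and an $x\in\mathbb{R}\cup\{\infty\}$, such that $$\phi(\mu)=\mu\circ(g\circ r_x)\qquad(\mu\in P_{ac}(\mathbb{R})).$$ Moreover, every transformation of this form is a surjective isometry of $P_{ac}(\mathbb{R})$ with respect to the Kuiper distance.
   Context: For Borel probability measures $\mu,\nu$ on $\mathbb{R}$ with distribution functions $f_\mu(t)=\mu((-\infty,t])$, the Kuiper distance is $d_{Ku}(\mu,\nu)=\sup_{t}(f_\mu(t)-f_\nu(t))+\sup_t(f_\nu(t)-f_\mu(t))$, which equals $\sup\{|\mu(I)-\nu(I)|: I\subseteq\mathbb{R}\text{ a non-degenerate interval}\}$. For $x\in\mathbb{R}$, $r_x\colon\mathbb{R}\setminus\{x\}\to\mathbb{R}$ is $r_x(t)=1/(t-x)$, and $r_\infty\colon\mathbb{R}\to\mathbb{R}$ is the identity. If $A$ is a Borel set and $G\colon A\to\mathbb{R}$ is injective and maps Borel sets to Borel sets, then $\mu\circ G$ denotes the Borel measure $(\mu\circ G)(B)=\mu(G(B\cap A))$ for Borel $B\subseteq\mathbb{R}$.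 *)

(* Defs.v *)
From HB Require Import structures.
From mathcomp Require Import all_boot all_order all_algebra.
From mathcomp Require Import all_classical all_reals all_analysis.
Set Implicit Arguments. Unset Strict Implicit. Unset Printing Implicit Defensive.
Import Order.TTheory GRing.Theory Num.Theory.
Local Open Scope classical_set_scope.
Local Open Scope ring_scope.

Definition Pac (R : realType) (mu : probability R R) : Prop :=
  (mu `<< (@lebesgue_measure R)).

Definition distrf (R : realType) (mu : set R -> \bar R) (t : R) : R :=
  fine (mu [set` `]-oo, t]]).

Definition dKu (R : realType) (mu nu : set R -> \bar R) : R :=
  sup (range (fun t => distrf mu t - distrf nu t)) +
  sup (range (fun t => distrf nu t - distrf mu t)).

(* r_x : R \ {x} -> R, r_x t = 1/(t-x); r_oo = id.  x = None encodes oo. *)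
Definition rx (R : realType) (x : option R) (t : R) : R :=
  match x with Some x0 => (t - x0)^-1 | None => t end.

Definition rx_dom (R : realType) (x : option R) : set R :=
  match x with Some x0 => [set t | t != x0] | None => setT end.

Definition mcomp (R : realType) (mu : set R -> \bar R) (A : set R) (G : R -> R)
  (B : set R) : \bar R := mu (G @` (B `&` A)).

Definition abs_cont_on (R : realType) (g : R -> R) (a b : R) : Prop :=
  forall eps : R, 0 < eps -> exists2 delta : R, 0 < delta &
    forall (n : nat) (s t : nat -> R),
      (forall i, (i < n)%N -> a <= s i /\ s i <= t i /\ t i <= b) ->
      (forall i j, (i < n)%N -> (j < n)%N -> i <> j -> t i <= s j \/ t j <= s i) ->
      \sum_(i < n) (t i - s i) < delta ->
      \sum_(i < n) `|g (t i) - g (s i)| < eps.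

(* Main.v *)
Require Import Defs.
From HB Require Import structures.
From mathcomp Require Import all_boot all_order all_algebra.
From mathcomp Require Import all_classical all_reals all_analysis.
From mathcomp Require Import measurable_realfun ring lra.
Import Order.TTheory GRing.Theory Num.Theory.
Import numFieldNormedType.Exports.
Local Open Scope classical_set_scope.
Local Open Scope ring_scope.
Set Implicit Arguments. Unset Strict Implicit. Unset Printing Implicit Defensive.

(** Compactify the line to a circle by a point oo. For absolutely continuous mu, nu the
    Kuiper distance is the maximum of mu(I) - nu(I) over half-open arcs I of the circle,
    so d(mu, nu) = 1 iff some arc carries mu and misses nu. If rho_I has full support in
    the arc I, then nu(I) = 0 iff d(nu, rho_I) = 1; hence a surjective isometry phi maps the
    measures carried by I onto those carried by an arc J, namely any arc separating
    phi(rho_I) from phi(rho_(I^c)). As 1 - mu(I) is the distance from mu to the measures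
    carried by I, even phi(mu)(J) = mu(I) for all mu. Applied to the increasing family of
    rays ]-oo, t], whose differences are again arcs, this gives arcs that all share an
    endpoint x. Sending x to oo by r_x turns them into rays, so that the distribution
    functions of mu and of the image of phi(mu) under r_x agree up to a change of variable
    h (and reflection). The map h is a homeomorphism preserving null sets in both directions
    because phi preserves absolute continuity in both directions.

    Conversely, homeomorphisms of the circle map arcs to arcs, and local absolute continuity
    of a monotone bijection is equivalent to the preservation of null sets. *)

(** * Probabilities and distribution functions *)

Section push.
Context d (T : measurableType d) (R : realType) (mu : probability T R) (f : T -> R).
Hypothesis mf : measurable_fun setT f.
(* The unused measurability argument lets the measure instance be inferred. *)
Definition push (_ : measurable_fun setT f) : set R -> \bar R := pushforward mu f.
Let push0 : push mf set0 = 0%E.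
Proof. by rewrite /push /pushforward preimage_set0 measure0. Qed.
Let push_ge0 A : (0 <= push mf A)%E.
Proof. exact: measure_ge0. Qed.
Let push_add : semi_sigma_additive (push mf).
Proof. exact: (@measure_semi_sigma_additive _ _ _ (pushforward mu f)). Qed.
HB.instance Definition _ := isMeasure.Build _ _ _ (push mf) push0 push_ge0 push_add.
Let pushT : push mf setT = 1%E.
Proof. by rewrite /push /pushforward preimage_setT probability_setT. Qed.
HB.instance Definition _ := Measure_isProbability.Build _ _ _ (push mf) pushT.
Definition push_prob : probability R R := push mf.
End push.

Section basics.
Context (R : realType).
Local Notation lam := (@lebesgue_measure R).
Implicit Types mu nu : probability R R.

Lemma PacP mu : Pac mu <-> (forall A, measurable A -> lam A = 0%E -> mu A = 0%E).
Proof. exact: null_content_dominatesP. Qed.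

Lemma lam_set1 (x : R) : lam [set x] = 0%E.
Proof. exact: lebesgue_measure_set1. Qed.

Lemma Pac_set1 mu (x : R) : Pac mu -> mu [set x] = 0%E.
Proof. by move/PacP; apply => //; exact: lam_set1. Qed.

(** Points are null for [mu]. This absorbs the choice between open and closed endpoints, and later
    the junk point of [rx]. *)
Lemma Pac_point_eq mu (A B : set R) (x : R) : Pac mu -> measurable A -> measurable B ->
  A `\ x = B `\ x -> mu A = mu B.
Proof.
move=> mup mA mB AB.
have h C : measurable C -> mu C = mu (C `\ x).
  move=> mC; rewrite measureD//; last by rewrite -ge0_fin_numE ?fin_num_measure.
  suff h0 : mu (C `&` [set x]) = 0%E by move: h0 => /= ->; rewrite sube0.
  apply/eqP; rewrite eq_le measure_ge0 andbT -(Pac_set1 x mup).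
  by apply: le_measure; rewrite ?inE//; apply: measurableI.
by rewrite h// AB -h.
Qed.

Definition pr mu (A : set R) : R := fine (mu A).

Lemma prK mu A : measurable A -> mu A = (pr mu A)%:E.
Proof. by move=> mA; rewrite /pr fineK// fin_num_measure. Qed.

Lemma pr_ge0 mu A : 0 <= pr mu A.
Proof. by rewrite /pr fine_ge0. Qed.

Lemma pr_le1 mu A : measurable A -> pr mu A <= 1.
Proof. by move=> mA; rewrite -lee_fin -prK// probability_le1. Qed.

Lemma pr_le mu A B : measurable A -> measurable B -> A `<=` B -> pr mu A <= pr mu B.
Proof. by move=> mA mB AB; rewrite -lee_fin -!prK// le_measure ?inE. Qed.

Lemma prC mu A : measurable A -> pr mu (~` A) = 1 - pr mu A.
Proof.
move=> mA; apply/EFin_inj; rewrite EFinB -!prK//; last exact: measurableC.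
exact: probability_setC.
Qed.

Lemma prD mu A B : measurable A -> measurable B -> A `<=` B ->
  pr mu (B `\` A) = pr mu B - pr mu A.
Proof.
move=> mA mB AB; apply/EFin_inj; rewrite EFinB -!prK//; last exact: measurableD.
rewrite measureD ?setIidr//; last by rewrite -ge0_fin_numE ?fin_num_measure.
Qed.

Lemma prU mu A B : measurable A -> measurable B -> A `&` B = set0 ->
  pr mu (A `|` B) = pr mu A + pr mu B.
Proof.
move=> mA mB AB; apply/EFin_inj; rewrite EFinD -!prK//; last exact: measurableU.
exact: measureU.
Qed.

Lemma pr_split mu A B : measurable A -> measurable B ->
  pr mu A = pr mu (A `&` B) + pr mu (A `&` ~` B).
Proof.
move=> mA mB; rewrite -prU; [ | exact: measurableI| | ].
- by rewrite -setIUr setUv setIT.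
- by apply: measurableI => //; exact: measurableC.
- by rewrite setIACA setICr setI0.
Qed.

Lemma pr_eq0 mu A : measurable A -> pr mu A = 0 <-> mu A = 0%E.
Proof. by move=> mA; rewrite prK//; split => [->//|[]]. Qed.

Lemma distrfE mu t : distrf mu t = pr mu `]-oo, t]. Proof. by []. Qed.


(** The identity as a random variable, so that facts about [cdf] apply to [distrf mu]. *)
Definition idR : R -> R := idfun.
#[local] HB.instance Definition _ :=
  @isMeasurableFun.Build _ _ _ _ idR (@measurable_id _ _ setT).

Lemma distrf_cdf mu : distrf mu = fine \o cdf (idR : {RV mu >-> R}).
Proof. by []. Qed.

Lemma distrf_cvgy mu : distrf mu @ +oo --> (1 : R).
Proof. by rewrite distrf_cdf; exact/fine_cvg/cvg_cdfy1. Qed.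

Lemma distrf_cvgNy mu : distrf mu @ -oo --> (0 : R).
Proof. by rewrite distrf_cdf; exact/fine_cvg/cvg_cdfNy0. Qed.

Lemma distrf_right_continuous mu : right_continuous (distrf mu).
Proof.
move=> a; rewrite distrf_cdf; apply: fine_cvg.
by rewrite /= fineK ?fin_num_measure//; exact: cdf_right_continuous.
Qed.

Lemma measurable_opp : measurable_fun [set: R] (-%R : R -> R).
Proof. exact: oppr_measurable. Qed.

Lemma distrfN mu t : Pac mu ->
  distrf (push_prob mu (measurable_opp)) t = 1 - distrf mu (- t).
Proof.
move=> mup; rewrite /distrf -/(pr mu _) -prC// /pr; congr fine.
apply: (@Pac_point_eq mu (-%R @^-1` `]-oo, t]) _ (-t)) => //.
- by rewrite -[X in measurable X]setTI; apply: measurable_opp.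
- exact: measurableC.
apply/seteqP; split => x /=; rewrite !in_itv/=.
  by move=> [h xt]; split => //; apply/negP; rewrite -ltNge lt_neqAle eq_sym;
    apply/andP; split; [exact/eqP|lra].
by move=> [/negP + ?]; rewrite -ltNge => ?; split => //; lra.
Qed.

(** Right continuity is general; left continuity at [t] is right continuity at [- t] for the
    reflected measure. *)
Lemma distrf_continuous mu : Pac mu -> continuous (distrf mu).
Proof.
move=> mup t; apply/left_right_continuousP; split; last exact: distrf_right_continuous.
pose nu := push_prob mu (measurable_opp).
apply/cvg_at_leftNP.
have E : distrf mu \o -%R = (fun x => 1 - distrf nu x).
  by apply/funext => x /=; rewrite distrfN//; lra.
have -> : distrf mu t = 1 - distrf nu (- t) by rewrite distrfN// opprK; lra.
rewrite E; apply: cvgB; first exact: cvg_cst.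
exact: distrf_right_continuous.
Qed.

Lemma distrf_unique (m1 m2 : probability R R) : (forall t, distrf m1 t = distrf m2 t) ->
  forall B, measurable B -> m1 B = m2 B.
Proof.
move=> F12 B mB.
apply: (@measure_unique _ R R (@RGenOInfty.G R) (fun n => `]- n%:R, +oo[%classic)) => //.
- exact: RGenOInfty.measurableE.
- move=> _ _ [x ->] [y ->]; exists (Num.max x y).
  apply/seteqP; split => z /=; rewrite !in_itv/= !andbT gt_max.
    by move=> [-> ->].
  by move=> /andP[].
- by move=> i; eexists; reflexivity.
- rewrite -subTset => x _; exists (Num.truncn `|x|).+1 => //=.
  rewrite in_itv/= andbT ltrNl; apply: le_lt_trans (truncnS_gt _).
  by rewrite -normrN ler_norm.
- move=> _ [x ->]; rewrite -setCitvl.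
  have mI := measurableC (@measurable_itv R `]-oo, x]).
  suff E : m1 (~` `]-oo, x]) = m2 (~` `]-oo, x]) :> \bar R by exact: E.
  by rewrite !prK// !prC// -!distrfE F12.
- by move=> k; rewrite -ge0_fin_numE// fin_num_measure.
Qed.

End basics.

(** * Arcs of the circle and the Kuiper distance *)

Section circle.
Context (R : realType).
Local Notation lam := (@lebesgue_measure R).
Implicit Types mu nu : probability R R.
Implicit Types p q : option R.

(* The circle is [option R], with [None] the point at infinity placed below all reals. *)
Definition lowray p : set R := if p is Some t then `]-oo, t]%classic else set0.

Definition circle_cdf mu p : R := if p is Some t then distrf mu t else 0.

Definition circle_le p q : bool :=
  match p, q with
  | None, _ => true
  | Some _, None => false
  | Some a, Some b => a <= b
  end.

(* The half-open arc ]p, q] run in the positive direction; it passes through infinity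
   when [q] is below [p]. *)
Definition arc p q : set R :=
  if circle_le p q then lowray q `\` lowray p else ~` (lowray p `\` lowray q).

Lemma measurable_lowray p : measurable (lowray p).
Proof. by case: p => [t|] /=. Qed.

Lemma measurable_arc p q : measurable (arc p q).
Proof.
rewrite /arc; case: ifPn => _; last apply: measurableC;
  apply: measurableD; exact: measurable_lowray.
Qed.
Hint Resolve measurable_lowray measurable_arc : core.

Lemma circle_cdfE mu p : circle_cdf mu p = pr mu (lowray p).
Proof. by case: p => [t//|] /=; rewrite /pr measure0. Qed.

Lemma circle_le_subset p q : circle_le p q -> lowray p `<=` lowray q.
Proof.
case: p q => [a|] [b|] //= ab x //=; rewrite !in_itv/= => xa.
exact: le_trans ab.
Qed.

Lemma circle_le_total p q : circle_le p q || circle_le q p.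
Proof. by case: p q => [a|] [b|] //=; exact: le_total. Qed.

Lemma circle_le_anti p q : circle_le p q -> circle_le q p -> p = q.
Proof.
case: p q => [a|] [b|] //= ab ba; congr Some; apply/eqP.
by rewrite eq_le ab ba.
Qed.

(** The last term is the total mass, picked up when the arc passes through infinity. It does not
    depend on [mu], so it cancels between two measures. *)
Lemma pr_arc mu p q : pr mu (arc p q) = circle_cdf mu q - circle_cdf mu p + (~~ circle_le p q)%:R.
Proof.
rewrite /arc !circle_cdfE; case: ifPn => pq /=; first by rewrite prD ?addr0//; exact: circle_le_subset.
have qp : circle_le q p by case/orP: (circle_le_total p q) => //; rewrite (negbTE pq).
by rewrite prC ?prD//; [lra | exact: circle_le_subset | exact: measurableD].
Qed.

Lemma arcC p q : p <> q -> ~` arc p q = arc q p.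
Proof.
move=> npq; rewrite /arc; case: ifPn => pq; case: ifPn => qp //.
- by case: npq; exact: circle_le_anti.
- by rewrite setCK.
- by have := circle_le_total p q; rewrite (negbTE pq) (negbTE qp).
Qed.

(** Extended by 0 at infinity, [H] is continuous on a compact circle, so its maximum is attained,
    possibly at [None]. *)
Lemma sup_attained (H : R -> R) : continuous H -> H @ +oo --> (0 : R) ->
  H @ -oo --> (0 : R) ->
  exists2 q, sup (range H) = oapp H 0 q &
    forall q', oapp H 0 q' <= oapp H 0 q.
Proof.
move=> cH Hy HNy; have [[t0 H0]|Hle0] := pselect (exists t0, 0 < H t0).
  (* Beyond [M] and [m] the values stay below [H t0], so the maximum over [[a, b]] is global. *)
  have [M [_ HM]] := cvgr_lt _ Hy _ H0.
  have [m [_ Hm]] := cvgr_lt _ HNy _ H0.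
  pose a := Num.min (m - 1) t0; pose b := Num.max (M + 1) t0.
  have at0 : a <= t0 by rewrite /a ge_min lexx orbT.
  have t0b : t0 <= b by rewrite /b le_max lexx orbT.
  have [|c cab cmax] := @EVT_max R H a b (le_trans at0 t0b).
    exact: continuous_subspaceT.
  have H0c : H t0 <= H c by apply: cmax; rewrite in_itv/= at0.
  have Hc t : H t <= H c.
    have [ta|ta] := ltP t a.
      apply: le_trans H0c; apply/ltW/Hm.
      have : a <= m - 1 by rewrite /a ge_min lexx.
      by lra.
    have [tb|tb] := ltP b t; last by apply: cmax; rewrite in_itv/= ta.
    apply: le_trans H0c; apply/ltW/HM.
    have : M + 1 <= b by rewrite /b le_max lexx.
    by lra.
  exists (Some c) => /= [|[t|]] /=; last 2 first.
  - exact: Hc.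
  - exact: le_trans (ltW H0) H0c.
  apply/eqP; rewrite eq_le; apply/andP; split.
    by apply: ge_sup; [exists (H c), c | move=> _ [t _ <-]].
  by apply: ub_le_sup; [exists (H c) => _ [t _ <-] | exists c].
have Hn t : H t <= 0 by rewrite leNgt; apply/negP => ?; apply: Hle0; exists t.
exists None => [|[t|]] //=.
apply/eqP; rewrite eq_le; apply/andP; split.
  by apply: ge_sup; [exists (H 0), 0 | move=> _ [t _ <-]].
rewrite leNgt; apply/negP => s0.
have /filter_ex[t] : \forall t \near +oo, sup (range H) < H t by exact: cvgr_gt Hy _ s0.
apply/negP; rewrite -leNgt; apply: ub_le_sup; last by exists t.
by exists 0 => _ [u _ <-].
Qed.

(** The two suprema are attained separately, at [q] and at [p]; their sum is the oscillation over
    the circle of the difference of the distribution functions. *)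
Lemma dKu_attained mu nu : Pac mu -> Pac nu ->
  exists2 pq : option R * option R,
    dKu mu nu = (circle_cdf mu pq.2 - circle_cdf nu pq.2) - (circle_cdf mu pq.1 - circle_cdf nu pq.1) &
    forall p q, (circle_cdf mu q - circle_cdf nu q) - (circle_cdf mu p - circle_cdf nu p) <= dKu mu nu.
Proof.
move=> mup nup.
have c : continuous (fun t => distrf mu t - distrf nu t).
  by move=> t; apply: cvgB; exact: distrf_continuous.
have cN : continuous (fun t => distrf nu t - distrf mu t).
  by move=> t; apply: cvgB; exact: distrf_continuous.
have y (m n : probability R R) : (fun t => distrf m t - distrf n t) @ +oo --> (0 : R).
  have := cvgB (distrf_cvgy m) (distrf_cvgy n); rewrite subrr => h; exact: h.
have Ny (m n : probability R R) : (fun t => distrf m t - distrf n t) @ -oo --> (0 : R).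
  have := cvgB (distrf_cvgNy m) (distrf_cvgNy n); rewrite subrr => h; exact: h.
have [q Eq qmax] := sup_attained c (y mu nu) (Ny mu nu).
have [p Ep pmax] := sup_attained cN (y nu mu) (Ny nu mu).
have HE (m n : probability R R) r : oapp (fun t => distrf m t - distrf n t) 0 r =
    circle_cdf m r - circle_cdf n r.
  by case: r => //=; rewrite subrr.
exists (p, q) => /= [|p' q']; rewrite /dKu Eq Ep !HE; first by lra.
by have := qmax q'; have := pmax p'; rewrite !HE; lra.
Qed.

Lemma dKu_ge_arc mu nu p q : Pac mu -> Pac nu ->
  pr mu (arc p q) - pr nu (arc p q) <= dKu mu nu.
Proof.
by move=> mup nup; have [_ _ /(_ p q)] := dKu_attained mup nup; rewrite !pr_arc; lra.
Qed.

Lemma dKu_arc mu nu : Pac mu -> Pac nu ->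
  exists p q, dKu mu nu = pr mu (arc p q) - pr nu (arc p q).
Proof.
move=> mup nup; have [[p q] /= E _] := dKu_attained mup nup.
by exists p, q; rewrite E !pr_arc; lra.
Qed.

(** * Normalised restrictions and a reference measure of full support *)

Section cond.
Context mu (A : set R) (mA : measurable A).

(** [mnormalize] falls back on [mu] itself when [mu A = 0], so absolute continuity of [mu] is
    inherited in every case. *)
Definition restrict_prob : probability R R := mnormalize (mrestr mu mA) mu.

Lemma restrict_probE B : restrict_prob B =
  if (mu (setT `&` A) == 0%E) || (mu (setT `&` A) == +oo%E) then mu B
  else (mu (B `&` A) * (fine (mu (setT `&` A)))^-1%:E)%E.
Proof.
transitivity ((if (mu (setT `&` A) == 0%E) || (mu (setT `&` A) == +oo%E) then fun U => mu U
  else fun U => (mu (U `&` A) * (fine (mu (setT `&` A)))^-1%:E)%E) B); first by [].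
by case: ifP.
Qed.

Lemma pr_restrict B : measurable B -> 0 < pr mu A -> pr restrict_prob B = pr mu (B `&` A) / pr mu A.
Proof.
move=> mB A0.
rewrite /pr restrict_probE setTI (prK mu mA) eqe gt_eqF//=.
by rewrite (prK mu (measurableI _ _ mB mA)) /= /pr.
Qed.

Lemma Pac_restrict : Pac mu -> Pac restrict_prob.
Proof.
move=> /PacP mup; apply/PacP => B mB B0.
rewrite restrict_probE; case: ifPn => _; first exact: mup.
suff -> : mu (B `&` A) = 0%E by rewrite mul0e.
apply/eqP; rewrite eq_le measure_ge0 andbT -(mup _ mB B0).
by apply: le_measure; rewrite ?inE//; exact: measurableI.
Qed.
End cond.

(** A reference measure with exactly the Lebesgue null sets; pushing along the identity only changes
    its type. *)
Definition gauss : probability R R :=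
  push_prob (normal_prob (0 : R) 1) (@measurable_id _ (measurableTypeR R) setT).

Lemma Pac_gauss : Pac gauss.
Proof. exact: normal_prob_dominates. Qed.

(** The density is positive everywhere. If its integral over [B] vanishes, it is 0 almost everywhere
    on [B], so [B] lies in a null set. *)
Lemma gauss_eq0 (B : set R) : measurable B -> gauss B = 0%E -> lam B = 0%E.
Proof.
move=> mB B0.
have p0 x : 0 < normal_pdf (0 : R) 1 x.
  by rewrite normal_pdfE ?oner_eq0// mulr_gt0 ?normal_peak_gt0 ?oner_eq0// expR_gt0.
have : ae_eq lam B (fun x => (normal_pdf (0 : R) 1 x)%:E) (cst 0%E).
  apply/(ae_eq_integral_abs lam mB).
    apply/measurable_EFinP; apply: measurable_funTS; exact: measurable_normal_pdf.
  under eq_integral do rewrite gee0_abs ?lee_fin ?normal_pdf_ge0//.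
  exact: B0.
move=> [N [mN N0 BN]]; apply/eqP; rewrite eq_le measure_ge0 andbT -N0.
apply: le_measure; rewrite ?inE// => x Bx; apply: BN => /= /(_ Bx) [] E.
by have := p0 x; rewrite E ltxx.
Qed.

End circle.
#[local] Hint Resolve measurable_lowray measurable_arc : core.

(** * Images of arcs under a surjective isometry *)

(* [lra] fails on (dis)equalities at an option type in the context. *)
Ltac lra_real := repeat match goal with
  | H : ~ @eq (option _) _ _ |- _ => clear H
  | H : @eq (option _) _ _ |- _ => clear H end; lra.

Section isometry.
Context (R : realType).
Local Notation lam := (@lebesgue_measure R).
Implicit Types mu nu : probability R R.
Implicit Types p q : option R.

Lemma measurable_arcC p q : measurable (~` arc p q).
Proof. by apply: measurableC; exact: measurable_arc. Qed.
Hint Resolve measurable_arcC : core.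

Lemma arc_itv p q : p <> q -> exists s t : R, s < t /\ `]s, t]%classic `<=` arc p q.
Proof.
case: p q => [a|] [b|] npq //; rewrite /arc /=.
- case: ifPn => [ab|].
    exists a, b; split; first by rewrite lt_neqAle ab andbT; apply/eqP => E; apply: npq; rewrite E.
    move=> x /=; rewrite !in_itv/= => /andP[ax xb]; split => //.
    by apply/negP; rewrite -ltNge.
  rewrite -ltNge => ba; exists a, (a + 1); split; first by lra_real.
  move=> x /=; rewrite !in_itv/= => /andP[ax _] [xa _]; by have := lt_le_trans ax xa; rewrite ltxx.
- exists a, (a + 1); split; first by lra_real.
  move=> x /=; rewrite !in_itv/= => /andP[ax _] [xa _]. by have := lt_le_trans ax xa; rewrite ltxx.
- exists (b - 1), b; split; first by lra_real.
  by move=> x /=; rewrite !in_itv/= => /andP[_ ?]; split.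
Qed.

Lemma gauss_gt0 (A : set R) (s t : R) : measurable A -> s < t -> `]s, t]%classic `<=` A ->
  0 < pr (gauss R) A.
Proof.
move=> mA st stA; apply: (@lt_le_trans _ _ (pr (gauss R) `]s, t])); last exact: pr_le.
rewrite lt_neqAle pr_ge0 andbT eq_sym; apply/eqP => /(pr_eq0 (gauss R) (measurable_itv _)).
move=> /(gauss_eq0 (measurable_itv _)).
by rewrite lebesgue_measure_itv /= lte_fin st -EFinD => -[]; lra_real.
Qed.

Lemma gauss_arc_gt0 p q : p <> q -> 0 < pr (gauss R) (arc p q).
Proof. by move=> /arc_itv[s [t [st sub]]]; exact: gauss_gt0 st sub. Qed.

Definition arc_gauss p q : probability R R := restrict_prob (gauss R) (measurable_arc p q).

Lemma Pac_arc_gauss p q : Pac (arc_gauss p q).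
Proof. apply: Pac_restrict; exact: Pac_gauss. Qed.
Hint Resolve Pac_arc_gauss : core.

Lemma pr_arcC mu p q : p <> q -> pr mu (arc q p) = 1 - pr mu (arc p q).
Proof. by move=> pq; rewrite -arcC// prC. Qed.

Lemma pr_arc_gauss_self p q : p <> q -> pr (arc_gauss p q) (arc p q) = 1.
Proof.
by move=> pq; rewrite pr_restrict ?gauss_arc_gt0// setIid divff// gt_eqF ?gauss_arc_gt0.
Qed.

Lemma dKu_le1 mu nu : Pac mu -> Pac nu -> dKu mu nu <= 1.
Proof.
move=> mup nup; have [p [q ->]] := dKu_arc mup nup.
have := pr_le1 mu (measurable_arc p q); have := pr_ge0 nu (arc p q); lra_real.
Qed.

Lemma dKuC mu nu : dKu mu nu = dKu nu mu.
Proof. by rewrite /dKu addrC. Qed.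

Lemma dKu_eq1 mu nu p q : Pac mu -> Pac nu -> pr mu (arc p q) = 1 ->
  pr nu (arc p q) = 0 -> dKu mu nu = 1.
Proof.
move=> mup nup E1 E0; apply/eqP; rewrite eq_le dKu_le1//=.
by have := dKu_ge_arc p q mup nup; rewrite E1 E0 subr0.
Qed.

(** At distance 1, some arc K has full [nu]-mass and no [arc_gauss]-mass. Full support makes the
    part of K in [arc p q] Lebesgue null, hence [nu]-null, so [nu] misses [arc p q]. Conversely, the
    complementary arc realises the distance. *)
Lemma dKu_arc_gauss p q nu : p <> q -> Pac nu ->
  (dKu nu (arc_gauss p q) = 1 <-> pr nu (arc p q) = 0).
Proof.
move=> pq nup; split=> [|E]; last first.
  apply: (@dKu_eq1 _ _ q p) => //; first by rewrite pr_arcC// E subr0.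
  by rewrite pr_arcC// pr_arc_gauss_self// subrr.
have [a [b ->]] := dKu_arc nup (Pac_arc_gauss p q) => E.
have nK : pr nu (arc a b) = 1.
  by have := pr_le1 nu (measurable_arc a b); have := pr_ge0 (arc_gauss p q) (arc a b); lra_real.
have rK : pr (arc_gauss p q) (arc a b) = 0 by lra_real.
have mI : measurable (arc a b `&` arc p q) by exact: measurableI.
have n0 : pr nu (arc a b `&` arc p q) = 0.
  apply/pr_eq0 => //; apply: (proj1 (PacP nu)) => //; apply: gauss_eq0 => //; apply/pr_eq0 => //.
  move: rK; rewrite pr_restrict ?gauss_arc_gt0// => /eqP; rewrite mulf_eq0 invr_eq0.
  by rewrite (gt_eqF (gauss_arc_gt0 pq)) orbF => /eqP.
have := pr_split nu (measurable_arc p q) (measurable_arc a b).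
rewrite setIC n0 add0r => ->; apply/eqP; rewrite eq_le pr_ge0 andbT.
have -> : 0 = pr nu (~` arc a b) by rewrite prC// nK subrr.
by apply: pr_le => [| |x []//]; [exact: measurableI|].
Qed.

(* The minimiser is the normalised restriction of mu to I, or any measure on I if mu(I) = 0. *)
Lemma dKu_to_arc mu p q : p <> q -> Pac mu -> exists nu,
  [/\ Pac nu, pr nu (arc p q) = 1 & dKu mu nu <= 1 - pr mu (arc p q)].
Proof.
move=> pq mup; have [m0|m0] := leP (pr mu (arc p q)) 0.
  exists (arc_gauss p q); split => //; [exact: pr_arc_gauss_self|].
  by have := @dKu_le1 mu (arc_gauss p q) mup (Pac_arc_gauss p q); lra_real.
pose nu := restrict_prob mu (measurable_arc p q).
have nup : Pac nu by exact: Pac_restrict.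
exists nu; split => //.
  by rewrite pr_restrict// setIid divff// gt_eqF.
have [a [b ->]] := dKu_arc mup nup.
rewrite pr_restrict// (pr_split mu (measurable_arc a b) (measurable_arc p q)).
(* Dividing by a mass at most 1 increases the part inside the arc, so only the mass of [mu] outside
   it can contribute positively to the difference. *)
have h1 : pr mu (arc a b `&` arc p q) <= pr mu (arc a b `&` arc p q) / pr mu (arc p q).
  by rewrite ler_peMr ?pr_ge0// invf_ge1// pr_le1.
have h2 : pr mu (arc a b `&` ~` arc p q) <= pr mu (~` arc p q).
  by apply: pr_le => [| |x []//]; [exact: measurableI|].
by move: h2; rewrite prC//; lra_real.
Qed.

(** * Jumps of distribution functions at finitely many points *)

Lemma exists_gap (xs : seq (option R)) (y : R) : exists2 e : R, 0 < e &
  forall z, Some z \in xs -> z <> y -> z <= y - e \/ y + e <= z.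
Proof.
elim: xs => [|x xs [e e0 IH]]; first by exists 1.
case: x => [z0|]; last first.
  by exists e => // z; rewrite inE /=; exact: IH.
have [->|zy] := eqVneq z0 y.
  by exists e => // z; rewrite inE => /orP[/eqP[->]//|]; exact: IH.
exists (Num.min e `|z0 - y|); first by rewrite lt_min e0 normr_gt0 subr_eq0.
move=> z; rewrite inE => /orP[/eqP[->] _|/IH h /h hz].
  have h : Num.min e `|z0 - y| <= `|z0 - y| by rewrite ge_min lexx orbT.
  by case: (leP 0 (z0 - y)) h => ?; [rewrite ger0_norm// | rewrite ltr0_norm//] => ?; lra_real.
have h' : Num.min e `|z0 - y| <= e by rewrite ge_min lexx.
by case: hz => ?; [left|right]; lra_real.
Qed.

Lemma exists_bound (xs : seq (option R)) : exists M : R,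
  forall z, Some z \in xs -> - M <= z <= M.
Proof.
elim: xs => [|x xs [M IH]]; first by exists 1.
case: x => [z0|]; last by exists M => z; rewrite inE /=; exact: IH.
exists (Num.max M `|z0|) => z; rewrite -ler_norml inE le_max => /orP[/eqP[->]|/IH].
  by rewrite lexx orbT.
by rewrite -ler_norml => ->.
Qed.

(** All mass is gained inside []s, t]], so off its interior the distribution function is a step,
    whatever the density. *)
Lemma circle_cdf_restrict (s t z : R) : s < t -> z <= s \/ t <= z ->
  circle_cdf (restrict_prob (gauss R) (measurable_itv `]s, t])) (Some z) = (t <= z)%R%:R.
Proof.
move=> st zst; rewrite circle_cdfE pr_restrict//; last exact: gauss_gt0 st (fun x h => h).
have p0 : pr (gauss R) `]s, t] != 0 by rewrite gt_eqF//; exact: gauss_gt0 st (fun x h => h).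
case: (leP t z) => tz.
  suff -> : (lowray (Some z) `&` `]s, t])%classic = `]s, t]%classic by rewrite divff.
  by apply/setIidr => x /=; rewrite !in_itv/= => /andP[_ xt]; exact: le_trans tz.
suff -> : (lowray (Some z) `&` `]s, t])%classic = set0 by rewrite /pr measure0 mul0r.
rewrite -subset0 => x []/=; rewrite !in_itv/= => xz /andP[sx _].
by case: zst; lra_real.
Qed.

(* Up to affine normalisation, differences of distribution functions realise the indicator
   of a point on any finite set: compare masses just left and just right of the point. *)
Lemma circle_cdf_separate (xs : seq (option R)) (y : option R) : exists nu1 nu2 (k e : R),
  [/\ Pac nu1, Pac nu2, e <> 0 &
    forall x, x \in xs -> circle_cdf nu1 x - circle_cdf nu2 x = k + e * (x == y)%:R].
Proof.
have Pc (s t : R) : Pac (restrict_prob (gauss R) (measurable_itv `]s, t])).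
  apply: Pac_restrict; exact: Pac_gauss.
case: y => [y|].
  have [e e0 gap] := exists_gap xs y.
  exists (restrict_prob (gauss R) (measurable_itv `]y - e, y])),
    (restrict_prob (gauss R) (measurable_itv `]y, y + e])), 0, 1; split => // [|[z|] zxs].
  - exact/eqP/oner_neq0.
  - have [zy|/eqP zy] := eqVneq z y.
      rewrite !circle_cdf_restrict; [|lra_real|left;lra_real|lra_real|right;lra_real].
      rewrite zy lexx eqxx.
      have -> : (y + e <= y) = false by apply/negbTE; rewrite -ltNge; lra_real.
      by rewrite /=; lra_real.
    have -> : (Some z == Some y) = false by apply/eqP => -[].
    case: (gap z zxs zy) => ?.
      rewrite !circle_cdf_restrict; [|lra_real|left;lra_real|lra_real|left;lra_real].
      rewrite !leNgt; have -> : z < y by lra_real.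
      have -> : z < y + e by lra_real.
      by rewrite /=; lra_real.
    rewrite !circle_cdf_restrict; [|lra_real|right;lra_real|lra_real|right;lra_real].
    have -> : y <= z by lra_real.
    have -> : y + e <= z by lra_real.
    by rewrite /=; lra_real.
  - by rewrite /=; lra_real.
have [M HM] := exists_bound xs.
(* Mass left of all listed finite points against mass right of them: the difference is 1 at these
   points and 0 at infinity, so [k = 1] and [e = -1]. *)
exists (restrict_prob (gauss R) (measurable_itv `]- M - 1, - M])),
  (restrict_prob (gauss R) (measurable_itv `]M, M + 1])), 1, (-1); split => // [|[z|] zxs].
- by apply/eqP; rewrite oppr_eq0 oner_neq0.
- have /andP[? ?] := HM z zxs.
  rewrite !circle_cdf_restrict; [|lra_real|left;lra_real|lra_real|right;lra_real].
  have -> : - M <= z by lra_real.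
  have -> : (M + 1 <= z) = false by apply/negbTE; rewrite -ltNge; lra_real.
  by rewrite /=; lra_real.
- by rewrite /=; lra_real.
Qed.

(* The indicator of ]p, q] jumps up at p and down at q; in an identity between such
   indicators the jumps cancel. *)
Lemma arc_additive (p1 q1 p2 q2 p3 q3 : option R) :
  p1 <> q1 -> p2 <> q2 -> p3 <> q3 ->
  (forall nu, Pac nu -> pr nu (arc p1 q1) = pr nu (arc p2 q2) + pr nu (arc p3 q3)) ->
  p1 = p2 \/ q1 = q2.
Proof.
move=> /eqP n1 /eqP n2 /eqP n3 H.
(* Subtracting the identities for [nu1] and [nu2] removes the wrap-around terms; [k] cancels within
   each arc, and dividing by [e] leaves the jumps at [y]. *)
have K y : (q1 == y)%:R - (p1 == y)%:R =
    (q2 == y)%:R - (p2 == y)%:R + ((q3 == y)%:R - (p3 == y)%:R) :> R.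
  have [nu1 [nu2 [k [e [P1 P2 /eqP e0 E]]]]] := circle_cdf_separate [:: q1; p1; q2; p2; q3; p3] y.
  have := H _ P1; have := H _ P2; rewrite !pr_arc.
  have := E q1; have := E p1; have := E q2; have := E p2; have := E q3; have := E p3.
  rewrite !inE !eqxx !orbT /= => /(_ isT) + /(_ isT) + /(_ isT) + /(_ isT) + /(_ isT) + /(_ isT).
  move=> ? ? ? ? ? ? ? ?; apply: (mulfI e0); lra_real.
have [|p12] := eqVneq p1 p2; first by left.
have [|q12] := eqVneq q1 q2; first by right.
(* The jump at [p1] forces [p3 = p1] and the jump at [q1] forces [q3 = q1]. The third arc is then
   the first, and nothing cancels the jump at [p2]. *)
exfalso.
have k1 := K p1; have k2 := K q1; have k3 := K p2.
move: k1 k2 k3; rewrite !eqxx [q1 == p1]eq_sym (negbTE n1) [p2 == p1]eq_sym (negbTE p12).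
rewrite [q2 == q1]eq_sym (negbTE q12) [q2 == p2]eq_sym (negbTE n2).
have [E1|p31] := eqVneq p3 p1; last first.
  by case: (q2 == p1); case: (q3 == p1) => /=; lra_real.
subst p3; rewrite (negbTE n1).
have [E2|q31] := eqVneq q3 q1; last first.
  by case: (p2 == q1) => /=; lra_real.
by subst q3; rewrite (negbTE p12) => _ _; case: (q1 == p2) => /=; lra_real.
Qed.

Context (phi : probability R R -> probability R R).
Hypothesis phi_Pac : forall mu, Pac mu -> Pac (phi mu).
Hypothesis phi_surj : forall nu, Pac nu -> exists mu, Pac mu /\
  forall B, measurable B -> phi mu B = nu B.
Hypothesis phi_iso : forall mu nu, Pac mu -> Pac nu -> dKu (phi mu) (phi nu) = dKu mu nu.

Lemma dKu_ext (m1 m2 n : probability R R) : (forall B, measurable B -> m1 B = m2 B) ->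
  dKu m1 n = dKu m2 n.
Proof.
move=> E; suff F : distrf m1 = distrf m2 by rewrite /dKu F.
by apply/funext => t; rewrite /distrf; congr fine; exact: E.
Qed.

(** Pull [arc_gauss b a] back to [eta]. It is at distance 1 from [arc_gauss p q], so it misses
    [arc p q]. Hence every [mu] carried by [arc p q] is at distance 1 from [eta], and [phi mu]
    misses [arc b a]. *)
Lemma arc_transfer p q a b : p <> q -> a <> b ->
  pr (phi (arc_gauss p q)) (arc b a) = 0 ->
  forall mu, Pac mu -> pr mu (arc p q) = 1 -> pr (phi mu) (arc a b) = 1.
Proof.
move=> pq ab E mu mup mu1; have ba : b <> a by move=> ?; apply: ab.
have [eta [etap Eeta]] := phi_surj (Pac_arc_gauss b a).
have d1 : dKu eta (arc_gauss p q) = 1.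
  by rewrite -phi_iso// (dKu_ext _ Eeta) dKuC; apply/(dKu_arc_gauss ba) => //; exact: phi_Pac.
have eta0 : pr eta (arc p q) = 0 by apply/(dKu_arc_gauss pq).
have : dKu mu eta = 1 by exact: dKu_eq1 mu1 eta0.
rewrite -phi_iso// dKuC (dKu_ext _ Eeta) dKuC => /(dKu_arc_gauss ba) => /(_ (phi_Pac mup)) E0.
by rewrite (pr_arcC _ ba) E0 subr0.
Qed.

(** The reference measures of the arc and of its complement are at distance 1, so some arc separates
    their images. Transfer for the arc and for its complement gives the two inequalities. *)
Lemma arc_image p q : p <> q -> exists a b, a <> b /\
  forall mu, Pac mu -> pr (phi mu) (arc a b) = pr mu (arc p q).
Proof.
move=> pq; have qp : q <> p by move=> ?; apply: pq.
have : dKu (phi (arc_gauss p q)) (phi (arc_gauss q p)) = 1.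
  rewrite phi_iso//; apply/dKu_arc_gauss => //.
  by rewrite pr_arcC// pr_arc_gauss_self// subrr.
have P1 := phi_Pac (Pac_arc_gauss p q); have P2 := phi_Pac (Pac_arc_gauss q p).
have [a [b ->]] := dKu_arc P1 P2 => E.
have E1 : pr (phi (arc_gauss p q)) (arc a b) = 1.
  by have := pr_le1 (phi (arc_gauss p q)) (measurable_arc a b);
    have := pr_ge0 (phi (arc_gauss q p)) (arc a b); lra_real.
have E0 : pr (phi (arc_gauss q p)) (arc a b) = 0 by lra_real.
have ab : a <> b.
  move=> ab; move: E; rewrite !pr_arc ab subrr.
  by case: (circle_le b b) => /=; lra_real.
have ba : b <> a by move=> ?; apply: ab.
exists a, b; split => // mu mup.
(* A nearest [nu] carried by [arc c d] has its image carried by [arc c' d'], so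
   [1 - pr (phi mu) (arc c' d')] is at most [dKu mu nu], hence at most [1 - pr mu (arc c d)]. *)
have half c d c' d' : c <> d -> c' <> d' ->
    (forall mu, Pac mu -> pr mu (arc c d) = 1 -> pr (phi mu) (arc c' d') = 1) ->
    pr mu (arc c d) <= pr (phi mu) (arc c' d').
  move=> cd cd' h; have [nu [nup nu1 dl]] := dKu_to_arc cd mup.
  have := dKu_ge_arc c' d' (phi_Pac nup) (phi_Pac mup).
  by rewrite (h _ nup nu1) phi_iso// dKuC; lra_real.
apply/eqP; rewrite eq_le; apply/andP; split; last first.
  apply: half => //; apply: arc_transfer => //.
  by rewrite pr_arcC// E1 subrr.
have := half _ _ _ _ qp ba (arc_transfer qp ba E0).
by rewrite (pr_arcC _ pq) (pr_arcC _ ab); lra_real.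
Qed.

Lemma ray_image : exists (x : option R) (q : R -> option R), (forall t, x <> q t) /\
  ((forall mu t, Pac mu -> pr (phi mu) (arc x (q t)) = distrf mu t) \/
   (forall mu t, Pac mu -> pr (phi mu) (arc (q t) x) = distrf mu t)).
Proof.
have /choice[pq Hpq] : forall t : R, exists ab : option R * option R, ab.1 <> ab.2 /\
    forall mu, Pac mu -> pr (phi mu) (arc ab.1 ab.2) = pr mu (arc None (Some t)).
  by move=> t; have [//|a [b [ab H]]] := @arc_image None (Some t); exists (a, b).
(* For [s < t] the ray to [t] is the ray to [s] plus the arc from [s] to [t]. The image arcs inherit
   this additivity because [phi] is surjective. *)
have share s t : (pq t).1 = (pq s).1 \/ (pq t).2 = (pq s).2.
  wlog st : s t / s < t => [wl|].
    have [st|st|->] := ltgtP s t; [exact: wl| |by left].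
    by have [E|E] := wl _ _ st; [left|right].
  have [|u [v [uv Huv]]] := @arc_image (Some s) (Some t).
    by case=> E; move: st; rewrite E ltxx.
  apply: (arc_additive _ _ uv); [exact: (Hpq t).1 | exact: (Hpq s).1 |].
  move=> nu nup; have [mu [mup Emu]] := phi_surj nup.
  have E B : measurable B -> pr nu B = pr (phi mu) B by move=> mB; rewrite /pr Emu.
  rewrite !E// Huv// (Hpq t).2// (Hpq s).2// !pr_arc /= (ltW st) /=.
  by lra_real.
have D mu t : Pac mu -> distrf mu t = pr mu (arc None (Some t)).
  by move=> _; rewrite pr_arc /= subr0 addr0.
have [[s [t npst]]|cst1] := pselect (exists s t, (pq t).1 <> (pq s).1); last first.
  exists (pq 0).1, (fun t => (pq t).2).
  have E t : (pq t).1 = (pq 0).1 by apply: contrapT => ?; apply: cst1; exists 0, t.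
  split=> [t|]; first by rewrite -(E t); exact: (Hpq t).1.
  by left => mu t mup; rewrite -(E t) (Hpq t).2// D.
have [//|qst] := share s t.
exists (pq s).2, (fun t => (pq t).1).
(* If [r] shared only the start with [s], it would not share the start of [t]; it would then share
   the end of [t], which is the end of [s]. *)
have E r : (pq r).2 = (pq s).2.
  apply: contrapT => nr; have [E1|//] := share s r.
  by have [E2|] := share t r; [apply: npst; rewrite -E1 -E2 | rewrite qst].
split=> [r|]; first by rewrite -(E r) => /esym; exact: (Hpq r).1.
by right => mu r mup; rewrite -(E r) (Hpq r).2// D.
Qed.

End isometry.

(** * Absolute continuity and null sets *)

Section null_sets.
Context (R : realType).
Local Notation RT := (measurableTypeR R).
Local Notation lam := (@lebesgue_measure R).

Lemma lam_itv (s t : R) : s <= t -> lam `]s, t]%classic = (t - s)%:E.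
Proof.
move=> st; rewrite lebesgue_measure_itv /= lte_fin.
by case: ltP => [_|ts]; [rewrite EFinB | rewrite (_ : t = s) ?subrr//; lra].
Qed.

Lemma trivIset_itv (n : nat) (s t : nat -> R) :
  (forall i, (i < n)%N -> s i <= t i) ->
  (forall i j, (i < n)%N -> (j < n)%N -> i <> j -> t i <= s j \/ t j <= s i) ->
  trivIset `I_n (fun i => `]s i, t i]%classic).
Proof.
move=> st dis i j /= iN jN [x []]; rewrite /= !in_itv/= => /andP[si ti] /andP[sj tj].
by apply: contrapT => /(dis _ _ iN jN)[]; lra.
Qed.

Lemma measure_itvs (m : {measure set RT -> \bar R}) (n : nat) (s t : nat -> R) :
  (forall i, (i < n)%N -> s i <= t i) ->
  (forall i j, (i < n)%N -> (j < n)%N -> i <> j -> t i <= s j \/ t j <= s i) ->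
  m (\big[setU/set0]_(i < n) `]s i, t i]%classic) = (\sum_(i < n) m `]s i, t i]%classic)%E.
Proof.
move=> st dis; apply: (@measure_semi_additive_ord_I _ _ _ m (fun i => `]s i, t i]%classic)) => //.
- exact: trivIset_itv.
- by apply: bigsetU_measurable.
Qed.

Section finpush.
Context (h : RT -> RT) (D : set RT) (mD : measurable D).
Hypothesis mh : measurable_fun setT h.
Hypothesis Dfin : (lam D < +oo)%E.

(** Finiteness of [D] in measure makes this image of Lebesgue measure a charge, for which domination
    has an epsilon-delta form. *)
Definition finpush (_ : measurable_fun setT h) (_ : (lam D < +oo)%E) : set RT -> \bar R :=
  pushforward (mrestr lam mD) h.
Let finpush0 : finpush mh Dfin set0 = 0%E.
Proof. by rewrite /finpush /pushforward preimage_set0 measure0. Qed.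
Let finpush_ge0 A : (0 <= finpush mh Dfin A)%E.
Proof. exact: (@measure_ge0 _ _ _ (pushforward (mrestr lam mD) h)). Qed.
Let finpush_add : semi_sigma_additive (finpush mh Dfin).
Proof. exact: (@measure_semi_sigma_additive _ _ _ (pushforward (mrestr lam mD) h)). Qed.
HB.instance Definition _ :=
  isMeasure.Build _ _ _ (finpush mh Dfin) finpush0 finpush_ge0 finpush_add.
Let finpush_fin : fin_num_fun (finpush mh Dfin).
Proof.
move=> A mA; rewrite ge0_fin_numE//; apply: le_lt_trans Dfin.
have mhA : measurable (h @^-1` A) by rewrite -[X in measurable X]setTI; exact: mh.
have := @le_measure _ _ _ lam (h @^-1` A `&` D) D; apply; rewrite ?inE//.
exact: measurableI.
Qed.
HB.instance Definition _ := @Measure_isFinite.Build _ _ _ (finpush mh Dfin) finpush_fin.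
End finpush.

(** With [h] in the role of the inverse of [g], [finpush] gives intervals the increments of [g].
    Preservation of null sets makes this finite measure dominated by [lam]; its epsilon-delta form
    on a union of disjoint intervals is the claim. *)
Lemma abs_cont_of_null (g h : R -> R) (a b : R) :
  measurable_fun [set: RT] (h : RT -> RT) ->
  (forall s t : R, s <= t -> lam (h @^-1` `]s, t]%classic) = `|g t - g s|%:E) ->
  (forall B : set RT, measurable B -> lam B = 0%E -> lam (h @^-1` B) = 0%E) ->
  a <= b -> abs_cont_on g a b.
Proof.
move=> mh HL N ab e e0.
pose D : set RT := h @^-1` `]a, b]%classic.
have mpre (B : set RT) : measurable B -> measurable (h @^-1` B : set RT).
  by move=> mB; rewrite -[X in measurable X]setTI; exact: mh.
have mD : measurable D by exact: mpre.
have Dfin : (lam D < +oo)%E by rewrite /D HL// ltry.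
pose nu := charge_of_finite_measure (finpush mD mh Dfin).
have [P [Q PQ]] := Hahn_decomposition nu.
have nulam : nu `<< lam.
  apply/null_content_dominatesP => A mA A0.
  apply/eqP; rewrite eq_le measure_ge0 andbT -(N _ mA A0).
  by apply: le_measure; rewrite ?inE//; [apply: measurableI => //|]; exact: mpre.
have [d [d0 Hd]] := charge_variation_continuous PQ nulam e0.
exists d => // n s t st dis sum_d.
have st' i : (i < n)%N -> s i <= t i by move=> /st[_ []].
pose A : set RT := \big[setU/set0]_(i < n) `]s i, t i]%classic.
have mA : measurable A by exact: bigsetU_measurable.
have lA : (lam A < d%:E)%E.
  rewrite /A measure_itvs// (eq_bigr (fun i : 'I_n => (t i - s i)%:E)).
    by rewrite sumEFin lte_fin.
  by move=> i _; apply: lam_itv; exact: st'.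
have E : finpush mD mh Dfin A = (\sum_(i < n) `|g (t i) - g (s i)|)%:E; last first.
  rewrite -lte_fin -E; apply: le_lt_trans (Hd _ mA lA).
  by apply: le_trans (abse_charge_variation PQ mA); exact: lee_abs.
rewrite /A (measure_itvs (finpush mD mh Dfin) st' dis).
rewrite -sumEFin; apply: eq_bigr => i _.
have [as_ [_ tb]] := st i (ltn_ord i).
rewrite -HL ?st'// /finpush /pushforward /mrestr; congr (lam _).
apply/setIidl => x; rewrite /D /= !in_itv/= => /andP[? ?].
by apply/andP; split; lra.
Qed.

(* An open set is exhausted, within ]a, b], by the dyadic intervals it contains; those of a
   given length are disjoint. Intervals not contained in U are collapsed to be empty. *)
Section grid.
Variables (a b : R) (U : set R).
Hypothesis ab : a <= b.
Let d (n : nat) : R := (b - a) / 2 ^+ n.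
Let s (n i : nat) : R := a + i%:R * d n.
Let t (n i : nat) : R := if `[< `]s n i, s n i + d n]%classic `<=` U >] then s n i + d n else s n i.

Let d_ge0 n : 0 <= d n.
Proof. by rewrite /d divr_ge0 ?subr_ge0// exprn_ge0. Qed.

Let dS n : d n.+1 = d n / 2.
Proof. by rewrite /d exprSr invfM mulrA. Qed.

Let sS n i x : s n i < x <= s n i + d n ->
  exists j, [/\ (j = i.*2 \/ j = i.*2.+1), s n.+1 j < x <= s n.+1 j + d n.+1 &
   s n i <= s n.+1 j /\ s n.+1 j + d n.+1 <= s n i + d n].
Proof.
move=> /andP[sx xs].
have dn := d_ge0 n.
have E0 : s n.+1 i.*2 = s n i by rewrite /s dS -muln2 natrM; lra.
have E1 : s n.+1 i.*2.+1 = s n i + d n / 2.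
  by rewrite /s dS -addn1 -muln2 natrD natrM; lra.
have [xm|xm] := leP x (s n i + d n / 2).
  by exists i.*2; rewrite E0 dS sx xm; split; [left | | lra].
exists i.*2.+1; rewrite E1 dS xm; split; [by right | lra | lra].
Qed.

Let bound i j n : (i < 2 ^ n)%N -> (j = i.*2 \/ j = i.*2.+1) -> (j < 2 ^ n.+1)%N.
Proof.
move=> i2 h; apply: (@leq_trans (i.+1).*2).
  by rewrite doubleS; case: h => ->; rewrite ?ltnS// leqnSn.
by rewrite expnS mul2n leq_double.
Qed.

Let cover n x : a < x <= b -> exists2 i, (i < 2 ^ n)%N & s n i < x <= s n i + d n.
Proof.
elim: n => [|n IH] xab; first by exists 0%N; rewrite // /s /d mul0r addr0 expr0 divr1; lra.
have [i i2 /sS[j [ji jx _]]] := IH xab.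
by exists j => //; exact: bound ji.
Qed.

Definition gridU n : set R := \bigcup_(i in `I_(2 ^ n)) `]s n i, t n i]%classic.

Let gridUP n x : gridU n x <-> exists i, [/\ (i < 2 ^ n)%N, s n i < x <= s n i + d n &
  `]s n i, s n i + d n]%classic `<=` U].
Proof.
split=> [[i /= iN]|[i [iN xi sub]]].
  rewrite /t; case: asboolP => sub; rewrite /= in_itv/= => /andP[? ?]; last by lra.
  by exists i; split => //; lra.
by exists i => //; rewrite /t asboolT//= in_itv.
Qed.

Lemma gridU_nd : nondecreasing_seq gridU.
Proof.
apply/nondecreasing_seqP => n; apply/subsetPset => x /gridUP[i [iN /sS[j [ji jx [s1 s2]]] sub]].
apply/gridUP; exists j; split => //; first exact: bound ji.
apply: subset_trans sub => y /=; rewrite !in_itv/= => /andP[? ?].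
by apply/andP; split; lra.
Qed.

Lemma gridU_subset n : gridU n `<=` U.
Proof.
by move=> x /gridUP[i [_ xi]]; apply; rewrite /= in_itv.
Qed.

(** Once the cell length [d n] is below the radius of a ball around [x] inside [U], the cell
    containing [x] lies in that ball. *)
Lemma gridU_cover : open U -> U `&` `]a, b]%classic `<=` \bigcup_n gridU n.
Proof.
move=> oU x [Ux]; rewrite /= in_itv/= => xab.
have /nbhs_ballP[e /= e0 eU] : nbhs x U by exact: open_nbhs_nbhs.
have [n de] : exists n, d n < e.
  have c : (fun n => (b - a) * (2^-1) ^+ n) @ \oo --> (0 : R).
    rewrite -[X in _ --> X](mulr0 (b - a)); apply: cvgM; first exact: cvg_cst.
    by apply: cvg_expr; rewrite ger0_norm ?invr_ge0// invf_lt1// ltr1n.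
  have /filter_ex[n Hn] : \forall n \near \oo, (b - a) * (2^-1) ^+ n < e by exact: cvgr_lt c _ e0.
  by exists n; rewrite /d -exprVn.
have [i i2 xi] := cover n xab.
exists n => //; apply/gridUP; exists i; split => // y; rewrite /= in_itv/= => yi.
by apply: eU; rewrite /ball/= ltr_norml; lra.
Qed.

Lemma gridU_itvs n : exists (k : nat) (u v : nat -> R),
  [/\ gridU n = \big[setU/set0]_(i < k) `]u i, v i]%classic,
   (forall i, (i < k)%N -> a <= u i /\ u i <= v i /\ v i <= b) &
   (forall i j, (i < k)%N -> (j < k)%N -> i <> j -> v i <= u j \/ v j <= u i)].
Proof.
have dn := d_ge0 n.
have st i : s n i <= t n i <= s n i + d n.
  by rewrite /t; case: asboolP => _; rewrite ?lexx ?lerDl ?dn.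
have inab i : (i < 2 ^ n)%N -> a <= s n i /\ s n i <= t n i /\ t n i <= b.
  move=> iN; have /andP[h1 h2] := st i; split; last split => //.
    by rewrite /s lerDl mulr_ge0.
  apply: le_trans h2 _.
  have -> : s n i + d n = a + i.+1%:R * d n by rewrite /s -addn1 natrD; lra.
  have -> : b = a + (2 ^ n)%:R * d n.
    by rewrite /d natrX mulrCA divff ?expf_neq0// mulr1; lra.
  by rewrite lerD2l ler_wpM2r// ler_nat.
have dis i j : (i < j)%N -> t n i <= s n j.
  move=> ij; have /andP[_ h2] := st i; apply: le_trans h2 _.
  have -> : s n i + d n = a + i.+1%:R * d n by rewrite /s -addn1 natrD; lra.
  by rewrite lerD2l ler_wpM2r// ler_nat.
have disj i j : (i < 2 ^ n)%N -> (j < 2 ^ n)%N -> i <> j -> t n i <= s n j \/ t n j <= s n i.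
  move=> _ _ /eqP; rewrite neq_ltn => /orP[/dis|/dis]; [by left|by right].
by exists (2 ^ n)%N, (s n), (t n); rewrite /gridU bigcup_mkord.
Qed.

End grid.

(** Enclose [N] in an open set of measure below [d]. Each grid stage is a finite union of intervals
    of total length below [d], so its [m]-mass is at most [e]; continuity from below gives the
    limit. *)
Lemma null_of_abs_cont (m : {measure set RT -> \bar R}) (a b : R) : a <= b ->
  (forall e : R, 0 < e -> exists2 d : R, 0 < d & forall (n : nat) (s t : nat -> R),
      (forall i, (i < n)%N -> a <= s i /\ s i <= t i /\ t i <= b) ->
      (forall i j, (i < n)%N -> (j < n)%N -> i <> j -> t i <= s j \/ t j <= s i) ->
      \sum_(i < n) (t i - s i) < d -> (\sum_(i < n) m `]s i, t i]%classic <= e%:E)%E) ->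
  forall N : set RT, measurable N -> lam N = 0%E -> m (N `&` `]a, b]%classic) = 0%E.
Proof.
move=> ab H N mN N0; apply/eqP; rewrite eq_le measure_ge0 andbT.
apply/lee_addgt0Pr => e e0; rewrite add0e.
have [d d0 Hd] := H e e0.
have Nfin : (lam N < +oo)%E by rewrite N0 ltry.
have [U [oU NU lU]] := lebesgue_regularity_outer mN Nfin d0.
have mU : measurable (U : set RT) by exact: open_measurable.
have {}lU : (lam U < d%:E)%E.
  have UN : lam (U `&` N) = 0%E.
    apply/eqP; rewrite eq_le measure_ge0 andbT -N0.
    by apply: le_measure; rewrite ?inE//; exact: measurableI.
  by have := measureDI lam mU mN; move: lU => /[swap] -> /=; rewrite UN adde0.
have mG n : measurable (gridU a b U n : set RT).
  by apply: bigcup_measurable.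
apply: (@le_trans _ _ (m (\bigcup_n gridU a b U n))).
  apply: le_measure; rewrite ?inE//; first exact: measurableI.
    by apply: bigcup_measurable.
  move=> x [Nx xab]; apply: gridU_cover => //; split => //; exact: NU.
have cv := nondecreasing_cvg_mu (mu := m) mG (bigcup_measurable (fun n _ => mG n))
  (gridU_nd U ab).
have /cvg_lim <- // := cv.
apply: lime_le.
  by apply/cvg_ex; eexists; exact: cv.
apply: nearW => n /=.
have [k [u [v [E h1 h2]]]] := gridU_itvs U ab n.
have uv i : (i < k)%N -> u i <= v i by move=> /h1[_ []].
have mE := measure_itvs m uv h2; have lE := measure_itvs lam uv h2.
rewrite E mE; apply: Hd => //.
rewrite -lte_fin -sumEFin; apply: le_lt_trans lU.
apply: (@le_trans _ _ (lam (gridU a b U n))).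
  rewrite E lE; apply: lee_sum => i _.
  by have := lam_itv (uv _ (ltn_ord i)) => /= ->.
by apply: le_measure; rewrite ?inE//; exact: gridU_subset.
Qed.

End null_sets.

(** * Monotone bijections *)

Section nonsing.
Context (R : realType).
Local Notation RT := (measurableTypeR R).
Local Notation lam := (@lebesgue_measure R).
Implicit Types mu nu : probability R R.

(** This is what makes the pushforward along [f] preserve absolute continuity. *)
Definition nonsing (f : R -> R) : Prop := measurable_fun [set: R] f /\
  forall B : set R, measurable B -> lam B = 0%E -> lam (f @^-1` B) = 0%E.

Lemma measurable_pre (f : R -> R) (B : set R) : measurable_fun [set: R] f ->
  measurable B -> measurable (f @^-1` B).
Proof. by move=> mf mB; rewrite -[X in measurable X]setTI; exact: mf. Qed.

Lemma Pac_push mu (f : R -> R) (mf : measurable_fun [set: R] f) : nonsing f ->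
  Pac mu -> Pac (push_prob mu mf).
Proof.
move=> [_ nf] /PacP mup; apply/PacP => B mB B0.
exact: (mup _ (measurable_pre mf mB) (nf B mB B0)).
Qed.

Lemma nonsing_comp (f1 f2 : R -> R) : nonsing f1 -> nonsing f2 -> nonsing (f1 \o f2).
Proof.
move=> [m1 n1] [m2 n2]; split; first exact: measurableT_comp.
by move=> B mB B0; apply: (n2 (f1 @^-1` B)); [exact: measurable_pre | exact: n1].
Qed.

Section lampush.
Context (h : RT -> RT).
Definition lampush (mh : measurable_fun setT h) : set RT -> \bar R := pushforward lam h.
Variable (mh : measurable_fun setT h).
Let lampush0 : lampush mh set0 = 0%E.
Proof. by rewrite /lampush /pushforward preimage_set0 measure0. Qed.
Let lampush_ge0 A : (0 <= lampush mh A)%E.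
Proof. exact: (@measure_ge0 _ _ _ (pushforward lam h)). Qed.
Let lampush_add : semi_sigma_additive (lampush mh).
Proof. exact: (@measure_semi_sigma_additive _ _ _ (pushforward lam h)). Qed.
HB.instance Definition _ :=
  isMeasure.Build _ _ _ (lampush mh) lampush0 lampush_ge0 lampush_add.
End lampush.

Lemma measure_bigcup0 (m : {measure set RT -> \bar R}) (F : nat -> set RT) (N : set RT) :
  measurable N -> (forall n, measurable (F n)) -> (forall n, m (F n) = 0%E) ->
  N `<=` \bigcup_n F n -> m N = 0%E.
Proof.
move=> mN mF F0 NF; have neg : m.-negligible N.
  apply: (negligibleS NF); apply: negligible_bigcup => n.
  by exists (F n); split.
exact: (measure_negligible mN neg).
Qed.

Definition monotone (g : R -> R) : Prop :=
  {mono g : x y / x <= y} \/ {mono g : x y /~ x <= y}.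

Lemma monotone_inv (g h : R -> R) : cancel h g -> monotone g -> monotone h.
Proof.
by move=> hK [] gm; [left|right] => x y; rewrite -gm !hK.
Qed.

Lemma monotone_measurable (g : R -> R) : monotone g -> measurable_fun [set: R] g.
Proof.
case=> gm.
- by apply: nondecreasing_measurable => // x y xy; rewrite gm.
- by apply: nonincreasing_measurable => // x y xy; rewrite gm.
Qed.

Lemma lam_itvco (s t : R) : s <= t -> lam `[s, t[%classic = (t - s)%:E.
Proof.
move=> st; rewrite lebesgue_measure_itv /= lte_fin.
by case: ltP => [_|ts]; [rewrite EFinB | rewrite (_ : t = s) ?subrr//; lra].
Qed.

(** The preimage under [h] is the image under [g]. The direction of [g] decides which endpoint is
    included, but not the length. *)
Lemma lam_monotone_itv (g h : R -> R) (s t : R) : cancel g h -> cancel h g -> monotone g ->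
  s <= t -> lam (h @^-1` `]s, t]%classic) = `|g t - g s|%:E.
Proof.
move=> gK hK gm st; case: (gm) => gm'.
- have hle x u : (h x <= u) = (x <= g u) by rewrite -gm' hK.
  have -> : h @^-1` `]s, t]%classic = `]g s, g t]%classic.
    by apply/seteqP; split => x; rewrite /= !in_itv/= !ltNge !hle.
  by rewrite lam_itv ?gm'// ger0_norm// subr_ge0 gm'.
have hle x u : (h x <= u) = (g u <= x) by rewrite -gm' hK.
have -> : h @^-1` `]s, t]%classic = `[g t, g s[%classic.
  by apply/seteqP; split => x; rewrite /= !in_itv/= !ltNge !hle andbC.
by rewrite lam_itvco ?gm'// ler0_norm ?opprB// subr_le0 gm'.
Qed.

(** For the image of Lebesgue measure under [h], absolute continuity of [g] on [[-n, n]] is the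
    hypothesis of [null_of_abs_cont]; the line is a countable union of such intervals. *)
Lemma monotone_nonsing (g h : R -> R) : cancel g h -> cancel h g -> monotone g ->
  (forall a b, a <= b -> abs_cont_on g a b) -> nonsing h.
Proof.
move=> gK hK gm gac.
have mh := monotone_measurable (monotone_inv hK gm).
split => // B mB B0.
pose m : {measure set RT -> \bar R} := lampush (mh : measurable_fun [set: RT] (h : RT -> RT)).
apply: (@measure_bigcup0 m (fun n => B `&` `](- n%:R : R), n%:R]%classic)) => //.
- by move=> n; exact: measurableI.
- move=> n; apply: null_of_abs_cont => //.
    by have : 0 <= n%:R :> R by []; lra.
  move=> e e0; have [|d d0 Hd] := gac (- n%:R) n%:R _ e e0.
    by have : 0 <= n%:R :> R by []; lra.
  exists d => // k s t st dis sd.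
  rewrite (eq_bigr (fun i : 'I_k => `|g (t i) - g (s i)|%:E)).
    by rewrite sumEFin lee_fin ltW// Hd.
  by move=> i _; apply: lam_monotone_itv => //; have [_ []] := st i (ltn_ord i).
- move=> x Bx; exists (Num.truncn `|x|).+1 => //=; split => //.
  have := truncnS_gt `|x|; rewrite ltr_norml => /andP[x1 x2].
  by rewrite /= in_itv/= x1 ltW.
Qed.

Lemma abs_cont_continuous (g : R -> R) :
  (forall a b, a <= b -> abs_cont_on g a b) -> continuous g.
Proof.
move=> gac x; apply/cvgrPdist_lt => e e0.
have [|d d0 Hd] := gac (x - 1) (x + 1) _ e e0; first by lra.
have m0 : 0 < Num.min d 1 by rewrite lt_min d0 /=.
near=> y.
have yd : `|x - y| < Num.min d 1 by near: y; apply/nbhs_ballP; exists (Num.min d 1).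
move: yd; rewrite lt_min => /andP[yd y1].
pose s (i : nat) := Num.min x y; pose t (i : nat) := Num.max x y.
have st : t 0%N - s 0%N = `|x - y|.
  rewrite /t /s; case: (leP x y) => xy; last by rewrite ger0_norm// subr_ge0 ltW.
  by rewrite distrC ger0_norm// subr_ge0.
have h1 i : (i < 1)%N -> x - 1 <= s i /\ s i <= t i /\ t i <= x + 1.
  move=> _; rewrite /s /t ge_max le_min; move: y1; rewrite ltr_norml => /andP[? ?].
  by split; [|split; [case: (leP x y) => ?; lra|]]; apply/andP; split; lra.
have h2 i j : (i < 1)%N -> (j < 1)%N -> i <> j -> t i <= s j \/ t j <= s i.
  by case: i j => [|i] [|j].
have := Hd 1%N s t h1 h2; rewrite !big_ord1 st => /(_ yd).
by rewrite /s /t; case: (leP x y) => _ //; rewrite distrC.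
Unshelve. all: by end_near. Qed.

Lemma bij_abs_cont_monotone (g h : R -> R) : cancel g h ->
  (forall a b, a <= b -> abs_cont_on g a b) -> monotone g.
Proof.
move=> gK /abs_cont_continuous gc.
have [|x y _ _|gm|gm] := @itv_continuous_inj_mono R g `]-oo, +oo[%R.
- by apply: continuous_subspaceT.
- exact: (can_inj gK).
- by left; apply: le_mono => x y xy; apply: gm; rewrite ?in_itv.
- by right; apply: le_nmono => x y xy; apply: gm; rewrite ?in_itv.
Qed.

End nonsing.

(** * Maps of the circle *)

Section circle_maps.
Context (R : realType).
Local Notation RT := (measurableTypeR R).
Local Notation lam := (@lebesgue_measure R).
Implicit Types mu nu : probability R R.

Lemma pr_ray_open mu (t : R) : Pac mu -> pr mu `]-oo, t[ = distrf mu t.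
Proof.
move=> mup; rewrite distrfE /pr; congr fine.
apply: (@Pac_point_eq _ mu `]-oo, t[ `]-oo, t] t) => //.
apply/seteqP; split => x /=; rewrite !in_itv/= => -[xt nx]; split => //; first exact: ltW.
by rewrite lt_neqAle xt andbT; apply/eqP.
Qed.

Lemma inv_le (y t : R) : (y^-1 <= t) =
  if t < 0 then (t^-1 <= y) && (y < 0) else (y <= 0) || (0 < t) && (t^-1 <= y).
Proof.
case: ifPn => t0.
  have [y0|y0] := ltP y 0; last first.
    by rewrite andbF; apply/negbTE; rewrite -ltNge (lt_le_trans t0)// invr_ge0.
  by rewrite andbT -[RHS]lef_nV2 ?negrE ?invr_lt0// invrK.
rewrite -leNgt in t0.
have [y0|y0] := leP y 0; first by rewrite (le_trans _ t0)// invr_le0.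
have [t0'|t0'] := ltP 0 t; first by rewrite -[RHS]lef_pV2 ?posrE ?invr_gt0// invrK.
by apply/negbTE; rewrite -ltNge (le_lt_trans t0')// invr_gt0.
Qed.

Lemma measurable_inv : measurable_fun [set: R] (GRing.inv : R -> R).
Proof.
apply: (measurability _ (RGenOInfty.measurableE R)) => //.
move=> _ [_ [t ->] <-]; rewrite setTI.
have -> : GRing.inv @^-1` `]t, +oo[%classic = ~` (GRing.inv @^-1` `]-oo, t]%classic).
  by rewrite -setCitvl.
apply: measurableC.
have -> : GRing.inv @^-1` `]-oo, t]%classic =
   if t < 0 then `[t^-1, 0[%classic else
     `]-oo, 0]%classic `|` (if 0 < t then `[t^-1, +oo[%classic else set0).
  apply/seteqP; split => y; rewrite /= in_itv/= inv_le.
    case: ifPn => _; first by rewrite /= in_itv.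
    case/orP => [y0|/andP[-> ty]]; [left|right] => //=; by rewrite in_itv/= ?andbT.
  case: ifPn => _; first by rewrite /= in_itv.
  move=> [|]; first by rewrite /= in_itv/= => ->.
  by case: ifPn => _ //; rewrite /= in_itv/= andbT orbC => ->.
case: ifPn => _ //; apply: measurableU => //.
by case: ifPn.
Qed.

Lemma null_of_lipschitz (m : {measure set RT -> \bar R}) (a b C : R) : a <= b -> 0 < C ->
  (forall s t : R, a <= s -> s <= t -> t <= b -> (m `]s, t]%classic <= (C * (t - s))%:E)%E) ->
  forall N : set RT, measurable N -> lam N = 0%E -> m (N `&` `]a, b]%classic) = 0%E.
Proof.
move=> ab C0 H; apply: null_of_abs_cont => // e e0.
exists (e / C); first exact: divr_gt0.
move=> n s t st _ sd.
apply: (@le_trans _ _ (\sum_(i < n) (C * (t i - s i))%:E)%E).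
  by apply: lee_sum => i _; have [? [? ?]] := st i (ltn_ord i); exact: H.
by rewrite sumEFin lee_fin -mulr_sumr mulrC -ler_pdivlMr// ltW.
Qed.

(** The condition [0 < s * t] puts both endpoints on one side of 0, where inversion is
    decreasing. *)
Lemma lam_inv_itv (s t : R) : s <= t -> 0 < s * t ->
  lam (GRing.inv @^-1` `]s, t]%classic) = (s^-1 - t^-1)%:E.
Proof.
move=> st st0.
have -> : GRing.inv @^-1` `]s, t]%classic = `[t^-1, s^-1[%classic.
  apply/seteqP; split => y; rewrite /= !in_itv/= [s < _]ltNge (inv_le y s) (inv_le y t).
    have [t0|t0] := ltP t 0.
      have -> : s < 0 by exact: le_lt_trans t0.
      by move=> /andP[+ /andP[-> y0]]; rewrite y0 andbT -ltNge.
    have s0 : 0 < s by nra.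
    rewrite (lt_gtF s0) /= s0 negb_or /= -!ltNge => /andP[/andP[y0 ys]].
    by rewrite (lt_geF y0) /= ys andbT => /andP[].
  have [t0|t0] := ltP t 0.
    have s0 : s < 0 by exact: le_lt_trans t0.
    rewrite s0 => /andP[-> ys].
    have y0 : y < 0 by rewrite (lt_trans ys)// invr_lt0.
    by rewrite y0 andbT -ltNge ys.
  have s0 : 0 < s by nra.
  have t0' : 0 < t by nra.
  rewrite (lt_gtF s0) /= s0 t0' negb_or /= -!ltNge => /andP[ty ys].
  have y0 : 0 < y by rewrite (lt_le_trans _ ty)// invr_gt0.
  by rewrite y0 ys ty orbT.
have ts : t^-1 <= s^-1.
  have : 0 <= (t - s) / (s * t) by rewrite divr_ge0 ?subr_ge0// ltW.
  have -> : (t - s) / (s * t) = s^-1 - t^-1.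
    by field; apply/andP; split; apply/eqP; nra.
  by rewrite subr_ge0.
by rewrite lam_itvco.
Qed.

(** Inversion is Lipschitz away from 0. The sets [F n] treat the points with [|x|] between [1/(n+1)]
    and [n+1] on each side, together with 0, and exhaust the line. *)
Lemma inv_nonsing : nonsing (GRing.inv : R -> R).
Proof.
split; first exact: measurable_inv.
move=> B mB B0.
pose m : {measure set RT -> \bar R} :=
  lampush (measurable_inv : measurable_fun [set: RT] (GRing.inv : RT -> RT)).
have lip (c a b : R) : a <= b -> 0 < c ->
    (forall s t, a <= s -> s <= t -> t <= b -> [/\ 0 < s * t, c <= `|s| & c <= `|t|]) ->
    m (B `&` `]a, b]%classic) = 0%E.
  move=> ab c0 H; apply: (@null_of_lipschitz _ _ _ (c^-1 * c^-1)) => //.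
    by rewrite mulr_gt0 ?invr_gt0.
  move=> s t as_ st tb; have [st0 cs ct] := H s t as_ st tb.
  rewrite [X in (X <= _)%E](lam_inv_itv st st0) lee_fin.
  have -> : s^-1 - t^-1 = s^-1 * t^-1 * (t - s).
    by field; apply/andP; split; apply/eqP; nra.
  rewrite ler_wpM2r ?subr_ge0//; apply: le_trans (ler_norm _) _.
  rewrite normrM !normfV ler_pM ?invr_ge0//.
    by rewrite lef_pV2 ?posrE//; exact: lt_le_trans cs.
  by rewrite lef_pV2 ?posrE//; exact: lt_le_trans ct.
have n0 (n : nat) : 0 < n.+1%:R^-1 :> R by rewrite invr_gt0.
have nn (n : nat) : n.+1%:R^-1 <= n.+1%:R :> R.
  by apply: (@le_trans _ _ 1); rewrite ?invf_le1 ?ler1n.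
pose F (n : nat) : set RT := (B `&` `](n.+1%:R^-1 : R), n.+1%:R]%classic) `|`
   ((B `&` `](- n.+1%:R : R), - n.+1%:R^-1]%classic) `|` [set (0 : R)]).
apply: (@measure_bigcup0 R m F) => //.
- move=> n; apply: measurableU; first exact: measurableI.
  by apply: measurableU => //; exact: measurableI.
- move=> n; rewrite measureU0//=.
  + apply: (lip n.+1%:R^-1) => // s t; move: (n.+1%:R^-1) (n0 n) => c c0 ? ? ?.
    have s0 : 0 < s by lra.
    have t0 : 0 < t by lra.
    by rewrite (gtr0_norm s0) (gtr0_norm t0); split; [exact: mulr_gt0 | lra | lra].
  + exact: measurableI.
  + by apply: measurableU => //; exact: measurableI.
  rewrite measureU0//=; first 1 last.
  + exact: measurableI.
  (* By the convention [0^-1 = 0], the preimage of 0 is 0 itself. *)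
  + have -> : m [set (0 : R)] = lam [set (0 : R)].
      congr (lam _); apply/seteqP; split => y /=; last by move=> ->; rewrite invr0.
      by move=> /(congr1 GRing.inv); rewrite invrK invr0.
    exact: lam_set1.
  apply: (lip n.+1%:R^-1) => //; first by rewrite lerN2.
  move=> s t; move: (n.+1%:R^-1) (n0 n) => c c0 ? ? ?.
  have s0 : s < 0 by lra.
  have t0 : t < 0 by lra.
  by rewrite (ltr0_norm s0) (ltr0_norm t0); split; [rewrite nmulr_rgt0 | lra | lra].
move=> x Bx.
have [->|x0] := eqVneq x 0; first by exists 0%N => //; right; right.
pose n := (maxn (Num.truncn `|x|) (Num.truncn `|x|^-1)).
have xn : `|x| < n.+1%:R.
  by apply: lt_le_trans (truncnS_gt _) _; rewrite ler_nat ltnS leq_maxl.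
have nx : n.+1%:R^-1 < `|x|.
  rewrite -[X in _ < X]invrK ltf_pV2 ?posrE ?invr_gt0 ?normr_gt0//.
  by apply: lt_le_trans (truncnS_gt _) _; rewrite ler_nat ltnS leq_maxr.
exists n => //; have [xp|xneg] := leP 0 x.
  by left; split => //; rewrite /= in_itv/=; move: xn nx; rewrite ger0_norm// => /ltW -> ->.
right; left; split => //; rewrite /= in_itv/=; move: xn nx; rewrite ltr0_norm// => x1 x2.
by rewrite ltrNl x1 lerNr ltW.
Qed.

(* Such a pushforward acts on differences of distribution functions by reindexing points of
   the circle, up to sign; [k] accounts for the choice of base point. *)
Definition circle_map (h : R -> R) (mh : measurable_fun [set: R] h) : Prop :=
  exists (s : option R -> option R) (e : bool) (c : option R -> R)
    (k : probability R R -> R), (forall p, exists q, s q = p) /\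
  forall mu p, Pac mu -> circle_cdf (push_prob mu mh) p = c p + k mu + (-1) ^+ e * circle_cdf mu (s p).

(** In a difference over two measures and two points, [c p] and [k mu] cancel, and a negative sign
    exchanges the points. Surjectivity of [s] gives the reverse inequality. *)
Lemma dKu_push h (mh : measurable_fun [set: R] h) mu nu :
  circle_map mh -> nonsing h -> Pac mu -> Pac nu ->
  dKu (push_prob mu mh) (push_prob nu mh) = dKu mu nu.
Proof.
move=> [s [e [c [k [sS E]]]]] nh mup nup.
have P1 := Pac_push mh nh mup; have P2 := Pac_push mh nh nup.
have [[p q] /= Ed Hd] := dKu_attained P1 P2.
have [[p' q'] /= Ed' Hd'] := dKu_attained mup nup.
have [a ap] := sS p'; have [b bq] := sS q'.
apply/eqP; rewrite eq_le; apply/andP; split.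
  rewrite Ed !E//; case: (e); rewrite ?expr1 ?expr0.
    by have := Hd' (s q) (s p); lra.
  by have := Hd' (s p) (s q); lra.
move: Hd; rewrite Ed'; case: (e) E; rewrite ?expr1 ?expr0 => E Hd.
  by have := Hd b a; rewrite !E// ap bq; lra.
by have := Hd a b; rewrite !E// ap bq; lra.
Qed.

Lemma monotone_circle_map (g h : R -> R) (mh : measurable_fun [set: R] h) :
  cancel g h -> cancel h g -> monotone g -> circle_map mh.
Proof.
move=> gK hK [] gm.
- exists (omap g), false, (fun=> 0), (fun=> 0); split.
    by move=> p; exists (omap h p); case: p => //= t; rewrite hK.
  move=> mu [t|] mup /=; rewrite ?add0r ?expr0 ?mul1r//.
  rewrite !distrfE; congr (pr mu _); apply/seteqP; split => x; rewrite /= !in_itv/=.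
    by rewrite -gm hK.
  by rewrite -[x]hK gm hK.
(* A decreasing [h] pulls []-oo, t]] back to [[g t, +oo[], of mass [1 - distrf mu (g t)]; hence the
   constant 1 at finite points. *)
- exists (omap g), true, (fun p => (p != None)%:R), (fun=> 0); split.
    by move=> p; exists (omap h p); case: p => //= t; rewrite hK.
  move=> mu [t|] mup /=; rewrite ?addr0 ?expr1 ?mulN1r//; last by rewrite ?eqxx /=; lra.
  rewrite -(pr_ray_open (g t) mup) -prC// distrfE; congr (pr mu _).
  apply/seteqP; split => x; rewrite /= !in_itv/=.
    by rewrite -gm hK => gx; apply/negP; rewrite -leNgt.
  by move/negP; rewrite -leNgt -[x]hK gm hK.
Qed.

Lemma distrf_inv nu t : Pac nu -> distrf (push_prob nu measurable_inv) t =
  distrf nu 0 + (0 < t)%R%:R - circle_cdf nu (if t == 0 then None else Some t^-1).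
Proof.
move=> nup; rewrite distrfE.
have -> : pr (push_prob nu measurable_inv) `]-oo, t] = pr nu [set y | y^-1 <= t].
  by congr (pr nu _); apply/seteqP; split => y; rewrite /= in_itv.
have [t0|t0|->] := ltgtP t 0; last first.
- rewrite /= subr0 addr0 distrfE; congr (pr nu _).
  by apply/seteqP; split => y; rewrite /= in_itv/= inv_le ltxx /= ?orbF.
- have -> : [set y | y^-1 <= t] = `]-oo, 0]%classic `|` ~` `]-oo, t^-1[%classic.
    apply/seteqP; split => y; rewrite /= !in_itv/= inv_le (lt_gtF t0)/=.
      by case/orP => [|/andP[_ ?]]; [left|right; apply/negP; rewrite -leNgt].
    by case=> [->//|/negP]; rewrite -leNgt t0 /= orbC => ->.
  rewrite prU//=; [|exact: measurableC|].
    by rewrite prC// (pr_ray_open _ nup) !distrfE; lra.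
  rewrite -subset0 => y; rewrite /= !in_itv/= => -[y0 /negP]; rewrite -leNgt => ty.
  have t1 : 0 < t^-1 by rewrite invr_gt0.
  by have := le_trans ty y0; rewrite leNgt t1.
have -> : [set y | y^-1 <= t] = `]-oo, 0[%classic `\` `]-oo, t^-1[%classic.
  apply/seteqP; split => y; rewrite /= !in_itv/= inv_le t0.
    by move=> /andP[ty ->]; split => //; apply/negP; rewrite -leNgt.
  by move=> [-> /negP]; rewrite -leNgt => ->.
rewrite prD//; last first.
  move=> y; rewrite /= !in_itv/= => /lt_trans; apply.
  by rewrite invr_lt0.
by rewrite !(pr_ray_open _ nup) /=; lra.
Qed.

(** Inversion exchanges 0 and infinity and reverses orientation. The term [distrf mu 0] appears
    because the base point at infinity is pulled back to 0. *)
Lemma inv_circle_map : circle_map measurable_inv.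
Proof.
exists (fun p => if p is Some t then (if t == 0 then None else Some t^-1) else Some 0), true,
  (fun p => if p is Some t then (0 < t)%R%:R else 0), (fun mu => distrf mu 0); split.
  move=> [t|]; last by exists (Some 0); rewrite eqxx.
  have [->|t0] := eqVneq t 0; first by exists None.
  by exists (Some t^-1); rewrite invr_eq0 (negbTE t0) invrK.
move=> mu [t|] mup; rewrite expr1 mulN1r; last by rewrite /= add0r subrr.
by rewrite {1}/circle_cdf distrf_inv//; lra.
Qed.

End circle_maps.

(** * Determination of the isometries *)

Section main.
Context (R : realType).
Local Notation lam := (@lebesgue_measure R).
Implicit Types mu nu : probability R R.

Lemma distrf_le mu s t : s <= t -> distrf mu s <= distrf mu t.
Proof.
move=> st; rewrite !distrfE; apply: pr_le => // x; rewrite /= !in_itv/= => xs.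
exact: le_trans st.
Qed.

Lemma distrf_gauss_lt s t : s < t -> distrf (gauss R) s < distrf (gauss R) t.
Proof.
move=> st; rewrite !distrfE -subr_gt0 -prD//; last first.
  by move=> x; rewrite /= !in_itv/= => xs; exact: le_trans (ltW st).
apply: (@gauss_gt0 R _ s t) => //; first exact: measurableD.
move=> x; rewrite /= !in_itv/= => /andP[sx xt]; split => //.
by apply/negP; rewrite -ltNge.
Qed.

Lemma distrf_gauss_inj : injective (distrf (gauss R)).
Proof.
move=> s t E; apply/eqP; rewrite eq_le !leNgt; apply/andP; split; apply/negP.
  by move=> /distrf_gauss_lt; rewrite E ltxx.
by move=> /distrf_gauss_lt; rewrite E ltxx.
Qed.

Section increasing.
Variables (T : probability R R -> probability R R) (h : R -> R).
Hypothesis T_Pac : forall mu, Pac mu -> Pac (T mu).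
Hypothesis T_surj : forall nu, Pac nu -> exists mu, Pac mu /\
  forall B, measurable B -> T mu B = nu B.
Hypothesis T_distrf : forall mu t, Pac mu -> distrf mu t = distrf (T mu) (h t).

(** Evaluated at [h], the distribution function of [T (gauss R)] is strictly increasing, which
    prevents [h] from reversing an order. *)
Let h_mono : {mono h : s t / s <= t}.
Proof.
apply: le_mono => s t st; rewrite ltNge; apply/negP => /(distrf_le (T (gauss R))).
rewrite -!T_distrf; [|exact: Pac_gauss..].
by rewrite leNgt distrf_gauss_lt.
Qed.

(** Take [eta] mapped to [gauss], so that [distrf eta] is [distrf (gauss R)] after [h]. It takes the
    value [distrf (gauss R) u] by the intermediate value theorem, and [distrf (gauss R)] is
    injective. *)
Let h_surj u : exists t, h t = u.
Proof.
have [eta [etap E]] := T_surj (@Pac_gauss R).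
have Eh t : distrf eta t = distrf (gauss R) (h t).
  by rewrite T_distrf// /distrf; congr fine; exact: E.
pose v := distrf (gauss R) u.
have v0 : 0 < v.
  by apply: (@le_lt_trans _ _ (distrf (gauss R) (u - 1))); [exact: pr_ge0 | apply: distrf_gauss_lt; lra].
have v1 : v < 1.
  apply: (@lt_le_trans _ _ (distrf (gauss R) (u + 1))); first by apply: distrf_gauss_lt; lra.
  exact: pr_le1.
have /filter_ex[a av] : \forall t \near -oo, distrf eta t < v.
  exact: cvgr_lt (distrf_cvgNy eta) _ v0.
have /filter_ex[b bv] : \forall t \near +oo, v < distrf eta t.
  exact: cvgr_gt (distrf_cvgy eta) _ v1.
have ab : a <= b.
  by rewrite leNgt; apply/negP => /ltW/(distrf_le eta); lra.
have [||t _ tv] := @IVT R (distrf eta) a b v ab.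
- by apply: continuous_subspaceT; exact: distrf_continuous.
- by rewrite ge_min le_max (ltW av) (ltW bv) orbT.
by exists t; apply: distrf_gauss_inj; rewrite -Eh.
Qed.

(** Equal distribution functions identify [T mu] with the image of [mu] under [h]. Null sets are
    tested on [gauss] and its image for [h], and on a preimage of [gauss] for [g]. *)
Lemma increasing_transport : exists g : R -> R,
  [/\ cancel g h, cancel h g, {mono h : s t / s <= t}, nonsing h & nonsing g] /\
  forall mu B, Pac mu -> measurable B -> T mu B = mu (h @^-1` B).
Proof.
have /choice[g gK] := h_surj.
have hK : cancel h g by move=> t; apply: (inc_inj h_mono); rewrite gK.
have hm : monotone h by left.
have mh := monotone_measurable hm.
have mg := monotone_measurable (monotone_inv gK hm).
have TE mu B : Pac mu -> measurable B -> T mu B = mu (h @^-1` B).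
  move=> mup mB; apply: (distrf_unique (m2 := push_prob mu mh)) => // t.
  rewrite -[in LHS](gK t) -T_distrf//; congr fine; congr (mu _).
  have hle y : (h y <= t) = (y <= g t) by rewrite -[RHS]h_mono gK.
  by apply/seteqP; split => y; rewrite /= !in_itv/= hle.
exists g; split => //; split => //; split => // B mB B0.
  apply: gauss_eq0; first exact: measurable_pre.
  rewrite -TE//; last exact: Pac_gauss.
  by apply: (proj1 (PacP _)) => //; apply: T_Pac; exact: Pac_gauss.
have [eta [etap E]] := T_surj (@Pac_gauss R).
have mgB := measurable_pre mg mB.
apply: gauss_eq0 => //; rewrite -E// TE//.
have -> : h @^-1` (g @^-1` B) = B by apply/seteqP; split => x; rewrite /= hK.
exact: (proj1 (PacP _)).
Qed.

End increasing.

Lemma abs_cont_isometry (g : R -> R) (a b : R) :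
  (forall s t, `|g t - g s| = `|t - s|) -> abs_cont_on g a b.
Proof.
move=> gi e e0; exists e => // n s t st _; congr (_ < _); apply: eq_bigr => i _.
by rewrite gi ger0_norm// subr_ge0; have [_ []] := st i (ltn_ord i).
Qed.

Lemma opp_monotone : monotone (-%R : R -> R).
Proof. by right => x y; rewrite lerN2. Qed.

Lemma add_monotone (c : R) : monotone (+%R^~ c).
Proof. by left => x y; rewrite lerD2r. Qed.

Lemma opp_nonsing : nonsing (-%R : R -> R).
Proof.
apply: (monotone_nonsing opprK opprK opp_monotone) => a b _.
by apply: abs_cont_isometry => s t; rewrite -opprD normrN.
Qed.

Lemma add_nonsing (c : R) : nonsing (+%R^~ c).
Proof.
apply: (@monotone_nonsing _ (+%R^~ (- c))) => [x|x||a b _]; rewrite /= ?subrK ?addrK//.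
  exact: add_monotone.
by apply: abs_cont_isometry => s t; congr `|_|; ring.
Qed.

(* With 0^-1 = 0 both [rx x] and [rx_inv x] are bijections of the whole line, the junk point
   being a null set. *)
Definition rx_inv (x : option R) (u : R) : R := if x is Some x0 then u^-1 + x0 else u.

Lemma rxK (x : option R) : cancel (rx x) (rx_inv x).
Proof. by case: x => // x0 t; rewrite /rx /rx_inv invrK subrK. Qed.

Lemma rx_invK (x : option R) : cancel (rx_inv x) (rx x).
Proof. by case: x => // x0 u; rewrite /rx /rx_inv addrK invrK. Qed.

Lemma id_nonsing : nonsing (id : R -> R).
Proof. by split => //; exact: measurable_id. Qed.

Lemma rx_nonsing (x : option R) : nonsing (rx x).
Proof.
case: x => [x0|]; last exact: id_nonsing.
exact: (nonsing_comp (inv_nonsing R) (add_nonsing (- x0))).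
Qed.

Lemma rx_inv_nonsing (x : option R) : nonsing (rx_inv x).
Proof.
case: x => [x0|]; last exact: id_nonsing.
exact: (nonsing_comp (add_nonsing x0) (inv_nonsing R)).
Qed.

(** The chart sends [x0] to infinity and reverses orientation, so an arc starting at [x0] becomes,
    up to a null set, the complement of a ray. The end [None] corresponds to [u = 0]. *)
Lemma arc_chart (x0 : R) (q : option R) : Some x0 <> q -> exists u, forall nu, Pac nu ->
  pr nu (arc (Some x0) q) = 1 - distrf (push_prob nu (rx_nonsing (Some x0)).1) u.
Proof.
move=> /eqP xq.
have F u nu : Pac nu -> distrf (push_prob nu (rx_nonsing (Some x0)).1) u =
    distrf nu x0 + (0 < u)%R%:R - circle_cdf nu (if u == 0 then None else Some (u^-1 + x0)).
  move=> nup.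
  have [ma na] := add_nonsing (- x0).
  have -> : distrf (push_prob nu (rx_nonsing (Some x0)).1) u =
            distrf (push_prob (push_prob nu ma) (measurable_inv (R := R))) u by [].
  rewrite distrf_inv; last exact: Pac_push.
  have D t : distrf (push_prob nu ma) t = distrf nu (t + x0).
    rewrite /distrf; congr fine; congr (nu _); apply/seteqP.
    by split => y; rewrite /= !in_itv/= lerBlDr.
  by rewrite D add0r; case: eqP => _ //=; rewrite D.
case: q xq => [q|] xq; last first.
  by exists 0 => nu nup; rewrite F// eqxx ltxx pr_arc /=; lra.
have qx : x0 != q by apply: contraNneq xq => ->.
exists ((q - x0)^-1) => nu nup; rewrite F// invr_eq0 subr_eq0 [q == x0]eq_sym (negbTE qx).
rewrite invrK subrK invr_gt0 subr_gt0 pr_arc /= -ltNge.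
have [xq'|xq'|E] := ltgtP x0 q; [by rewrite /=; lra | by rewrite /=; lra |].
by rewrite E eqxx in qx.
Qed.

(** The image under a bijection is the preimage under its inverse, and deleting [x0] from [B]
    removes only a null point. *)
Lemma mcomp_push mu (g h : R -> R) (x : option R)
    (mK : measurable_fun [set: R] (rx_inv x \o h)) B :
  cancel g h -> cancel h g -> Pac (push_prob mu mK) -> measurable B ->
  mcomp mu (rx_dom x) (g \o rx x) B = push_prob mu mK B.
Proof.
move=> gK hK pp mB; rewrite /mcomp.
have -> : (g \o rx x) @` (B `&` rx_dom x) = (rx_inv x \o h) @^-1` (B `&` rx_dom x).
  apply/seteqP; split => [_ [y By <-]|y By]; first by rewrite /preimage /= gK rxK.
  by exists (rx_inv x (h y)) => //=; rewrite rx_invK hK.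
case: x mK pp => [x0|] mK pp; last by rewrite setIT.
apply: (@Pac_point_eq _ (push_prob mu mK) (B `&` rx_dom (Some x0)) B x0) => //.
  apply: measurableI => //; rewrite (_ : rx_dom _ = ~` [set x0]); first exact: measurableC.
  by apply/seteqP; split => y /= /eqP.
apply/seteqP; split => y; first by move=> [[]].
by move=> [By yx]; split => //; split => //=; exact/eqP.
Qed.

Lemma isometry_form (phi : probability R R -> probability R R) :
  (forall mu, Pac mu -> Pac (phi mu)) ->
  (forall nu, Pac nu -> exists mu, Pac mu /\
     forall B, measurable B -> phi mu B = nu B) ->
  (forall mu nu, Pac mu -> Pac nu -> dKu (phi mu) (phi nu) = dKu mu nu) ->
  exists (g : R -> R) (x : option R),
    bijective g /\
    (forall a b : R, a <= b -> abs_cont_on g a b) /\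
    (forall h : R -> R, cancel g h -> cancel h g ->
       forall a b : R, a <= b -> abs_cont_on h a b) /\
    forall mu, Pac mu -> forall B, measurable B ->
      phi mu B = mcomp mu (rx_dom x) (g \o rx x) B.
Proof.
move=> phi_Pac phi_surj phi_iso.
have [x [q [xq Hq]]] := ray_image phi_Pac phi_surj phi_iso.
have chart t : exists u, forall nu, Pac nu -> 
    distrf (push_prob nu (rx_nonsing x).1) u = if x is Some _ then 1 - pr nu (arc x (q t))
      else pr nu (arc x (q t)).
  case: x xq {Hq} => [x0|] xq.
    have [u Hu] := arc_chart (xq t).
    by exists u => nu nup; rewrite Hu//; lra.
  case: (q t) (xq t) => // u _; exists u => nu nup.
  by rewrite pr_arc /= subr0 addr0.
have /choice[k Hk] := chart.
(* The map [e] is the identity or the reflection. The choice depends on whether the arcs start or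
   end at [x] and whether [x] is finite, and makes the change of variable increasing. *)
have [e [eK me ne kE]] : exists e : R -> R, [/\ cancel e e, monotone e, nonsing e &
    forall (me : measurable_fun [set: R] e) mu t, Pac mu ->
    distrf mu t = distrf (push_prob (push_prob (phi mu) (rx_nonsing x).1) me) (e (k t))].
  have Hid : (forall mu t, Pac mu -> distrf mu t = distrf (push_prob (phi mu) (rx_nonsing x).1) (k t)) ->
    exists e : R -> R, [/\ cancel e e, monotone e, nonsing e &
    forall (me : measurable_fun [set: R] e) mu t, Pac mu ->
    distrf mu t = distrf (push_prob (push_prob (phi mu) (rx_nonsing x).1) me) (e (k t))].
    move=> H; exists id; split => //; first by left.
  have Hopp : (forall mu t, Pac mu ->
    distrf mu t = 1 - distrf (push_prob (phi mu) (rx_nonsing x).1) (k t)) ->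
    exists e : R -> R, [/\ cancel e e, monotone e, nonsing e &
    forall (me : measurable_fun [set: R] e) mu t, Pac mu ->
    distrf mu t = distrf (push_prob (push_prob (phi mu) (rx_nonsing x).1) me) (e (k t))].
    move=> H; exists -%R; split => //; [exact: opprK | exact: opp_monotone | exact: opp_nonsing |].
    move=> me mu t mup; rewrite H// -[in LHS](opprK (k t)).
    rewrite -distrfN//; apply: Pac_push; [exact: rx_nonsing | exact: phi_Pac].
  have qx t : q t <> x by move=> E; exact: (xq t).
  have fin : (if x is Some _ then True else False) \/ x = None.
    by case: (x); [left|right].
  case: Hq => Hq; case: fin => xE.
  - apply: Hopp => mu t mup; rewrite -Hq// Hk; last exact: phi_Pac.
    by case: (x) xE => // x0 _; lra.
  - apply: Hid => mu t mup; rewrite -Hq// Hk; last exact: phi_Pac.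
    by rewrite xE.
  - apply: Hid => mu t mup; rewrite -Hq// Hk; last exact: phi_Pac.
    rewrite (pr_arcC _ (qx t)).
    by case: (x) xE => // x0 _; lra.
  - apply: Hopp => mu t mup; rewrite -Hq// Hk; last exact: phi_Pac.
    by rewrite (pr_arcC _ (qx t)) xE; lra.
pose f := e \o rx x; pose fi := rx_inv x \o e.
have fK : cancel f fi by move=> t; rewrite /f /fi /= eK rxK.
have fiK : cancel fi f by move=> t; rewrite /f /fi /= rx_invK eK.
have nf : nonsing f := nonsing_comp ne (rx_nonsing x).
have nfi : nonsing fi := nonsing_comp (rx_inv_nonsing x) ne.
pose T mu := push_prob (phi mu) nf.1.
have T_Pac mu : Pac mu -> Pac (T mu) by move=> mup; apply: Pac_push => //; exact: phi_Pac.
have T_surj nu : Pac nu -> exists mu, Pac mu /\ forall B, measurable B -> T mu B = nu B.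
  move=> nup; have [mu [mup E]] := phi_surj _ (Pac_push nfi.1 nfi nup).
  exists mu; split => // B mB; rewrite /T [LHS]E; last exact: measurable_pre nf.1 mB.
  by congr (nu _); apply/seteqP; split => y; rewrite /preimage /= fiK.
have T_distrf mu t : Pac mu -> distrf mu t = distrf (T mu) (e (k t)).
  by move=> mup; rewrite (kE ne.1 mu t mup).
have [g1 [[g1K h1K h1m nh1 ng1] TE]] := increasing_transport T_Pac T_surj T_distrf.
set h1 := fun t => e (k t) in g1K h1K h1m nh1 TE.
(* Undoing the chart leaves [phi mu] as the image of [mu] under [rx_inv x \o e \o h1]; the
   reflection [e] is absorbed into [g]. *)
pose h := e \o h1; pose g := g1 \o e.
have gK : cancel g h by move=> t; rewrite /g /h /= g1K eK.
have hK : cancel h g by move=> t; rewrite /g /h /= eK h1K.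
have nh : nonsing h := nonsing_comp ne nh1.
have ng : nonsing g := nonsing_comp ng1 ne.
have g1m : {mono g1 : s t / s <= t} by move=> s t; rewrite -h1m !g1K.
have gm : monotone g.
  by case: me => em; [left|right] => s t; rewrite /g /= g1m em.
have hm := monotone_inv hK gm.
have gac a b : a <= b -> abs_cont_on g a b.
  move=> ab; apply: (@abs_cont_of_null R g h a b nh.1) => // [s t st|B mB B0].
    exact: lam_monotone_itv.
  exact: nh.2.
have hac a b : a <= b -> abs_cont_on h a b.
  move=> ab; apply: (@abs_cont_of_null R h g a b ng.1) => // [s t st|B mB B0].
    exact: lam_monotone_itv.
  exact: ng.2.
exists g, x; split; first by exists h.
split => //; split.
  move=> h' gK' h'K; suff -> : h' = h by [].
  by apply/funext => y; rewrite -{1}[y]hK gK'.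
have nK : nonsing (rx_inv x \o h) := nonsing_comp (rx_inv_nonsing x) nh.
move=> mu mup B mB; rewrite (mcomp_push (mK := nK.1) gK hK)//; last exact: Pac_push.
transitivity (T mu (fi @^-1` B)); last exact: TE mup (measurable_pre nfi.1 mB).
congr (phi mu _); by apply/seteqP; split => y; rewrite /preimage /= fK.
Qed.

(** The transformation is a pushforward along [h], then for finite [x] along inversion and a
    translation. Each is a nonsingular circle map, so each preserves the distance. *)
Lemma form_isometry (g : R -> R) (x : option R) :
  bijective g ->
  (forall a b : R, a <= b -> abs_cont_on g a b) ->
  (forall h : R -> R, cancel g h -> cancel h g ->
     forall a b : R, a <= b -> abs_cont_on h a b) ->
  exists psi : probability R R -> probability R R,
    (forall mu, Pac mu -> forall B, measurable B ->
       psi mu B = mcomp mu (rx_dom x) (g \o rx x) B) /\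
    (forall mu, Pac mu -> Pac (psi mu)) /\
    (forall nu, Pac nu -> exists mu, Pac mu /\
       forall B, measurable B -> psi mu B = nu B) /\
    (forall mu nu, Pac mu -> Pac nu ->
       dKu (psi mu) (psi nu) = dKu mu nu).
Proof.
move=> [h gK hK] gac /(_ h gK hK) hac.
have gm := bij_abs_cont_monotone gK gac.
have hm := monotone_inv hK gm.
have nh := monotone_nonsing gK hK gm gac.
have ng := monotone_nonsing hK gK hm hac.
have nK : nonsing (rx_inv x \o h) := nonsing_comp (rx_inv_nonsing x) nh.
have nG : nonsing (g \o rx x) := nonsing_comp ng (rx_nonsing x).
exists (fun mu => push_prob mu nK.1); split.
  by move=> mu mup B mB; rewrite (mcomp_push (mK := nK.1) gK hK)//; exact: Pac_push.
split; first by move=> mu mup; exact: Pac_push.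
split.
  move=> nu nup; exists (push_prob nu nG.1); split; first exact: Pac_push.
  by move=> B mB; congr (nu _); apply/seteqP; split => y; rewrite /preimage /= gK rxK.
move=> mu nu mup nup.
have ch : circle_map nh.1 by exact: monotone_circle_map gK hK gm.
rewrite -(dKu_push ch nh mup nup).
have P1 := Pac_push nh.1 nh mup; have P2 := Pac_push nh.1 nh nup.
case: x nK {nG} => [x0|] nK; last by [].
have ni := inv_nonsing R.
rewrite -(dKu_push (inv_circle_map R) ni P1 P2).
have Q1 := Pac_push (measurable_inv (R := R)) ni P1.
have Q2 := Pac_push (measurable_inv (R := R)) ni P2.
have na := add_nonsing x0.
have ca : circle_map na.1.
  apply: (@monotone_circle_map _ (+%R^~ (- x0))) => [t|t|]; rewrite /= ?addrK ?subrK//.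
  exact: add_monotone.
by rewrite -(dKu_push ca na Q1 Q2).
Qed.

End main.

Theorem theorem1p2 (R : realType) :
  (forall phi : probability R R -> probability R R,
     (forall mu, Pac mu -> Pac (phi mu)) ->
     (forall nu, Pac nu -> exists mu, Pac mu /\
        forall B, measurable B -> phi mu B = nu B) ->
     (forall mu nu, Pac mu -> Pac nu ->
        dKu (phi mu) (phi nu) = dKu mu nu) ->
     exists (g : R -> R) (x : option R),
       bijective g /\
       (forall a b : R, a <= b -> abs_cont_on g a b) /\
       (forall h : R -> R, cancel g h -> cancel h g ->
          forall a b : R, a <= b -> abs_cont_on h a b) /\
       forall mu, Pac mu -> forall B, measurable B ->
         phi mu B = mcomp mu (rx_dom x) (g \o rx x) B)
  /\
  (forall (g : R -> R) (x : option R),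
     bijective g ->
     (forall a b : R, a <= b -> abs_cont_on g a b) ->
     (forall h : R -> R, cancel g h -> cancel h g ->
        forall a b : R, a <= b -> abs_cont_on h a b) ->
     exists psi : probability R R -> probability R R,
       (forall mu, Pac mu -> forall B, measurable B ->
          psi mu B = mcomp mu (rx_dom x) (g \o rx x) B) /\
       (forall mu, Pac mu -> Pac (psi mu)) /\
       (forall nu, Pac nu -> exists mu, Pac mu /\
          forall B, measurable B -> psi mu B = nu B) /\
       (forall mu nu, Pac mu -> Pac nu ->
          dKu (psi mu) (psi nu) = dKu mu nu)).
Proof.
split; first by move=> phi; exact: isometry_form.
by move=> g x; exact: form_isometry.
Qed.
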